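(* Let $V$ be a Hilbert space and $X\colon[0,N]\to V$ a rectifiable process, with $N\ge1$ an integer. For any given $b\in T_1^m(V)$, and for each choice of sign $\pm$, the functional $$v\in V^{\otimes(m+1)}\mapsto\mathbb{E}\int_0^N\big\|\pi_{m+1}(Z_t^\pm(X,b+v))\big\|^2_{V^{\otimes(m+1)}}\,|\mathrm{d}X_t|$$ has a unique minimum at the value $$b^*=-\frac{1}{\mathbb{E}\int_0^N|\mathrm{d}X_t|}\,\mathbb{E}\int_0^N\pi_{m+1}\big(Z_t^\pm(X,(b,0))\big)\,|\mathrm{d}X_t|,$$ where $(b,0)\in T_1^{m+1}(V)$ is the trivial extension of $b$ to $T_1^{m+1}(V)$ obtained by setting $\pi_{m+1}(b,0)=0$.
   Context: A rectifiable process is a stochastic process whose trajectories are a.s. continuous and of bounded variation; $|\mathrm{d}X_t|$ is the total variation measure of the path $X$. $V^{\otimes n}$ is the $n$-th tensor power of $V$, with the canonical extension of the Hilbert bracket of $V$. $T^m(V)$ is the truncated tensor algebra up to degree $m$ (an integer $m\ge0$), $\pi_n$ is the projection onto $V^{\otimes n}$, and $T_1^m(V)=\{v\in T^m(V):\pi_0(v)=1\}$. For $b\in T_1^m(V)$ and $v\in V^{\otimes(m+1)}$, $b+v$ means $(b,0)+v\in T_1^{m+1}(V)$. $[t]$ is the integer part of $t$, and $X$ is extended beyond $N$ by its constant value $X_N$. The forward ($+$) and backward ($-$) truncated sawtooth signatures with initial datum $b$ are the paths $Z^\pm(X,b)$ on $[0,N]$ with $\pi_0(Z_t^\pm(X,b))=1$,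 $$\pi_1(Z_t^+(X,b))=X_t-X_{[t]}+\pi_1(b),\qquad \pi_1(Z_t^-(X,b))=X_t-X_{[t+1]}+\pi_1(b),$$ and, for $l\ge2$ up to the truncation degree, $\mathrm{d}\pi_l(Z_t^\pm(X,b))=\mathrm{d}X_t\otimes\pi_{l-1}(Z_t^\pm(X,b))$ with $\pi_l(Z_0^\pm(X,b))=\pi_l(b)$.
   Formalization: The formal theorem additionally assumes that the expected length of X is positive and finite, so that b* is defined, and that the functional is finite for at least one v; if it is infinite everywhere, every v is a minimizer and uniqueness fails. *)

(* Defs.v *)
From HB Require Import structures.
From mathcomp Require Import all_boot all_order all_algebra.
From mathcomp Require Import all_classical all_reals all_analysis.

Set Implicit Arguments.
Unset Strict Implicit.
Unset Printing Implicit Defensive.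
Import Order.TTheory GRing.Theory Num.Theory.
Import numFieldNormedType.Exports.

Local Open Scope classical_set_scope.
Local Open Scope ring_scope.

HB.mixin Record CompleteNormedModule_isHilbert (R : realType) V
    of CompleteNormedModule R V := {
  hdot : {dot V for (@idfun R)} ;
  hdot_norm : forall x : V, hdot x x = `|x| ^+ 2 }.

#[short(type="hilbertType")]
HB.structure Definition Hilbert (R : realType) :=
  {V of CompleteNormedModule_isHilbert R V & CompleteNormedModule R V}.

(* The Hilbert tensor powers of V, presented by their defining properties, which
   determine them up to a unique isometry compatible with the products:
   tpow n is the completion of the algebraic tensor power for the extension
   <v (x) a, w (x) b> = <v, w> <a, b> of the scalar product, and tens is the
   product V x V^(n) -> V^(n+1).  The degree-0 power is the line of tone, the
   unit of the tensor algebra, and v |-> tens v tone identifies V with the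
   degree-1 power. *)
Record tensorPowers (R : realType) (V : hilbertType R) := TensorPowers {
  tpow :> nat -> hilbertType R ;
  tone : tpow 0%N ;
  tens : forall n, V -> tpow n -> tpow n.+1 ;
  tone_norm : `|tone| = 1 ;
  tone_span : forall a : tpow 0%N, exists c : R, a = c *: tone ;
  tens_linearl : forall n (a : tpow n), linear (fun v => tens v a) ;
  tens_linearr : forall n (v : V), linear (@tens n v) ;
  tens_dot : forall n (v w : V) (a b : tpow n),
    hdot (tens v a) (tens w b) = hdot v w * hdot a b ;
  tens_dense : forall n, closure
    [set a : tpow n.+1 | exists s : seq (V * tpow n),
      a = \sum_(p <- s) tens p.1 p.2] = setT }.

Section truncated_tensor_algebra.
Context {R : realType} {V : hilbertType R} (T : tensorPowers V).

(* The truncated tensor algebra of order m is seen inside the product of all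
   tensor powers, as the sequences that vanish in degree > m. *)
Definition tseries := forall l, T l.

Definition T1 (m : nat) : set tseries :=
  [set b | b 0%N = tone T /\ forall l, (m < l)%N -> b l = 0].

(* (b, 0) + v, for b truncated at order m and v of degree m + 1 *)
Definition extend m (b : tseries) (v : T m.+1) : tseries :=
  @dfwith nat (fun l => T l) b m.+1 v.

End truncated_tensor_algebra.

Section rectifiable_paths.
Context {R : realType} {V : normedModType R}.
Implicit Types (a b t : R) (x : R -> V).

(* Vector-valued versions of variation, variations, bounded_variation and
   total_variation, which the library restricts to real-valued functions. *)
Definition vvariation a b x (s : seq R) : R :=
  let F := x \o nth b (a :: s) in \sum_(0 <= n < size s) `|F n.+1 - F n|.

Definition vvariations a b x : set R :=
  [set vvariation a b x s | s in itv_partition a b].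

Definition vbounded_variation a b x := has_ubound (vvariations a b x).

Definition vtotal_variation a b x : \bar R :=
  ereal_sup [set r%:E | r in vvariations a b x].

Definition rectifiable_path (N : nat) x :=
  {within `[0, N%:R], continuous x} /\ vbounded_variation 0 N%:R x.

Definition tv_function (N : nat) x t : R :=
  fine (vtotal_variation 0 (Num.min (Num.max t 0) N%:R) x).

(* The total variation measure |dX| of a path on [0, N], as the
   Lebesgue-Stieltjes measure of t |-> |dX|([0, t]).  For a rectifiable path
   this function is a cumulative one; the other branch is a junk value. *)
Definition tv_measure (N : nat) x :
    {measure set (measurableTypeR R) -> \bar R} :=
  match pselect (exists f : cumulative R R, f =1 tv_function N x) with
  | left p => lebesgue_stieltjes_measure (projT1 (cid p))
  | right _ => mzero
  end.

End rectifiable_paths.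

Section sawtooth.
Context {R : realType} {V : hilbertType R} {T : tensorPowers V}.

(* Riemann-Stieltjes integral of dx (x) f over [a, b], as the limit of the sums
   over tagged partitions a < s_0 < ... < b whose mesh tends to 0.  It exists
   for x continuous of bounded variation and f regulated (f may jump at the
   integers below). *)
Definition is_RS_integral n (x : R -> V) (f : R -> T n) (a b : R)
    (I : T n.+1) :=
  forall e : R, 0 < e -> exists2 dlt : R, 0 < dlt &
    forall (s : seq R) (u : nat -> R), itv_partition a b s ->
      let p := nth b (a :: s) in
      (forall i, (i < size s)%N ->
        p i <= u i <= p i.+1 /\ p i.+1 - p i < dlt) ->
      `|I - \sum_(0 <= i < size s) tens (x (p i.+1) - x (p i)) (f (u i))| < e.

Definition RS_integral n (x : R -> V) (f : R -> T n) (a b : R) : T n.+1 :=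
  xget 0 (is_RS_integral x f a b).

Variant direction := Forward | Backward.

Definition reset_time (dir : direction) (t : R) : R :=
  match dir with
  | Forward => (Num.floor t)%:~R
  | Backward => (Num.floor (t + 1))%:~R
  end.

(* sawtooth dir N x b l t is the degree-l component of the sawtooth signature
   at time t in [0, N]; capping the reset time at N amounts to extending x
   beyond N by the constant x N. *)
Fixpoint sawtooth (dir : direction) (N : nat) (x : R -> V) (b : tseries T)
    (l : nat) : R -> T l :=
  match l return R -> T l with
  | 0%N => fun=> tone T
  | k.+1 =>
    match k return (R -> T k) -> R -> T k.+1 with
    | 0%N => fun _ t =>
        tens (x t - x (Num.min (reset_time dir t) N%:R)) (tone T) + b 1%N
    | k'.+1 => fun Zk t => b k'.+2 + RS_integral x Zk 0 t
    end (sawtooth dir N x b k)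
  end.

End sawtooth.

Section bochner.
Context d (S : measurableType d) (R : realType) (H : normedModType R).
Variable mu : {measure set S -> \bar R}.
Implicit Types (D : set S) (f s : S -> H).

Definition simple_function s :=
  finite_set (range s) /\ forall y, measurable (s @^-1` [set y]).

Definition simple_integral D s : H :=
  \sum_(y \in range s) fine (mu (D `&` s @^-1` [set y])) *: y.

(* a.e. limit of simple functions; when H is separable, this is Borel
   measurability up to a negligible set *)
Definition strongly_measurable D f := exists2 s : nat -> S -> H,
  (forall n, simple_function (s n)) &
  {ae mu, forall x, D x -> s ^~ x @ \oo --> f x}.

Definition is_bochner_integral D f (I : H) := exists s : nat -> S -> H,
  [/\ forall n, simple_function (s n) /\
        (forall y, y != 0 -> (mu (D `&` s n @^-1` [set y]) < +oo)%E),
      {ae mu, forall x, D x -> s ^~ x @ \oo --> f x},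
      (\int[mu]_(x in D) (`|f x - s n x|)%:E)%E @[n --> \oo] --> 0%E &
      simple_integral D (s n) @[n --> \oo] --> I].

Definition bochner_integral D f : H := xget 0 (is_bochner_integral D f).

End bochner.

Section sawtooth_functional.
Context {R : realType} {V : hilbertType R} {T : tensorPowers V}.
Context d (Omega : measurableType d) (P : probability Omega R).
Variables (N : nat) (X : R -> Omega -> V).

Definition rectifiable_process :=
  (forall t, t \in `[0, N%:R] -> strongly_measurable P setT (X t)) /\
  {ae P, forall w, rectifiable_path N (X ^~ w)}.

Definition expected_length : \bar R :=
  (\int[P]_w \int[tv_measure N (X ^~ w)]_(t in `[0%R, N%:R]) 1)%E.

Definition expected_square (dir : direction) m (b : tseries T) (v : T m.+1)
    : \bar R :=
  (\int[P]_w \int[tv_measure N (X ^~ w)]_(t in `[0%R, N%:R])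
     (`|sawtooth dir N (X ^~ w) (extend b v) m.+1 t| ^+ 2)%:E)%E.

Definition optimal_datum (dir : direction) m (b : tseries T) : T m.+1 :=
  - ((fine expected_length)^-1 *:
     bochner_integral P setT (fun w =>
       bochner_integral (tv_measure N (X ^~ w)) `[0, N%:R]
         (sawtooth dir N (X ^~ w) (extend b (0 : T m.+1)) m.+1))).

End sawtooth_functional.

(* Main.v *)
(** The datum v only shifts the component of degree m + 1 of the sawtooth
    signature Z by v.  Along each path the integral of |Z + v|^2 against |dX| is
    therefore q + 2 <I, v> + L |v|^2, where q and I are the integrals of |Z|^2
    and Z and L is the length; the functional is a quadratic polynomial in v
    with leading coefficient E L > 0, and completing the square gives its
    minimum.  Since the polynomial is nonnegative at every v, finiteness at one
    point makes q integrable and 2 |I| <= q + L makes I integrable.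

    Measurability and the existence of all integrals come from evaluation on the
    grids of step 1/(n+1).  Each component of Z is a uniform limit of its values
    at the left grid points (its jumps are at integers, which are grid points),
    so Riemann-Stieltjes integrals, total variations and integrals against |dX|
    are limits of finite sums involving X at rational times only.  A
    modification on one null set makes these countably many variables pointwise
    limits of simple functions and all paths rectifiable. *)
From HB Require Import structures.
From mathcomp Require Import all_boot all_order all_algebra.
From mathcomp Require Import all_classical all_reals all_analysis.
From mathcomp Require Import measurable_realfun ring lra.
Require Import Defs.
Set Implicit Arguments.
Unset Strict Implicit.
Unset Printing Implicit Defensive.
Import Order.TTheory GRing.Theory Num.Theory.
Import numFieldNormedType.Exports.
Local Open Scope classical_set_scope.
Local Open Scope ring_scope.


(** Two obstacles shape the proof. The process is measurable only at fixed times and up to null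
    sets, [V] may be nonseparable, and the expectations are taken of functions of w that are not
    known to be measurable.

    Its substitute [grid_regular] is strong enough for all the integrals and survives the recursion
    over degrees. It holds for both signs because the reset time is constant on each [k, k+1), and t
    lies in the same such interval as its left grid point.

    Vector integrals are treated through their scalar products with a vector h, which reduces
    identities to real integrals. A norm estimate for a difference u is the case h = u, which reads
    |u|^2 <= |u| * error. *)

Section hilbert_space.
Context {R : realType} {H : hilbertType R}.
Implicit Types x y z : H.

Lemma hdotC x y : hdot x y = hdot y x.
Proof. by rewrite hermC /= expr0 mul1r. Qed.

Lemma hdotDl x y z : hdot (x + y) z = hdot x z + hdot y z.
Proof. exact: linearDl. Qed.

Lemma hdotZl (a : R) x z : hdot (a *: x) z = a * hdot x z.
Proof. exact: linearZl_LR. Qed.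

Lemma hdotDr x y z : hdot z (x + y) = hdot z x + hdot z y.
Proof. by rewrite !(hdotC z) hdotDl. Qed.

Lemma hdotZr (a : R) x z : hdot z (a *: x) = a * hdot z x.
Proof. by rewrite !(hdotC z) hdotZl. Qed.

Lemma hdotNl x z : hdot (- x) z = - hdot x z.
Proof. by rewrite -scaleN1r hdotZl mulN1r. Qed.

Lemma hdotBl x y z : hdot (x - y) z = hdot x z - hdot y z.
Proof. by rewrite hdotDl hdotNl. Qed.

Lemma hdot0l z : hdot 0 z = 0.
Proof. by rewrite -(scale0r 0) hdotZl mul0r. Qed.

Lemma hdot_suml (I : Type) (s : seq I) (Q : pred I) (F : I -> H) z :
  hdot (\sum_(i <- s | Q i) F i) z = \sum_(i <- s | Q i) hdot (F i) z.
Proof.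
by elim/big_rec2: _ => [|i y1 y2 _ <-]; rewrite ?hdot0l ?hdotDl.
Qed.

Lemma normD_sqr x y : `|x + y| ^+ 2 = `|x| ^+ 2 + 2 * hdot x y + `|y| ^+ 2.
Proof. by rewrite -!hdot_norm !hdotDl !hdotDr (hdotC y x); ring. Qed.

(** Cauchy-Schwarz: the quadratic polynomial c |-> |x + c y|^2 is nonnegative, in particular at its
    minimum. *)
Lemma hdot_le x y : `|hdot x y| <= `|x| * `|y|.
Proof.
have [->|y0] := eqVneq y 0; first by rewrite hdotC hdot0l !normr0 mulr0.
have ny : 0 < `|y| by rewrite normr_gt0.
have h (c : R) : 0 <= `|x| ^+ 2 + 2 * (c * hdot x y) + c ^+ 2 * `|y| ^+ 2.
  rewrite -hdotZr (_ : c ^+ 2 * `|y| ^+ 2 = `|c *: y| ^+ 2).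
    by rewrite -normD_sqr sqr_ge0.
  by rewrite normrZ exprMn real_normK ?num_real.
(* The minimiser of the polynomial in [h]. *)
have := h (- hdot x y / `|y| ^+ 2).
set p := hdot x y => hp.
have : p ^+ 2 <= (`|x| * `|y|) ^+ 2.
  have y2 : 0 < `|y| ^+ 2 by rewrite exprn_gt0.
  have e : `|x| ^+ 2 + 2 * (- p / `|y| ^+ 2 * p) +
      (- p / `|y| ^+ 2) ^+ 2 * `|y| ^+ 2 = `|x| ^+ 2 - p ^+ 2 / `|y| ^+ 2.
    by field; rewrite gt_eqF.
  by move: hp; rewrite e subr_ge0 ler_pdivrMr// exprMn.
by rewrite -[p ^+ 2]real_normK ?num_real// ler_sqr// nnegrE mulr_ge0.
Qed.

End hilbert_space.

(** * Products with a vector in the tensor powers *)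

Section tensor_products.
Context {R : realType} {V : hilbertType R} (T : tensorPowers V).

Lemma tensDl n (v w : V) (a : T n) : tens (v + w) a = tens v a + tens w a.
Proof. by have := tens_linearl a 1 v w; rewrite !scale1r. Qed.

Lemma tensDr n (v : V) (a b : T n) : tens v (a + b) = tens v a + tens v b.
Proof. by have := tens_linearr v 1 a b; rewrite !scale1r. Qed.

Lemma tens0l n (a : T n) : tens (0 : V) a = 0.
Proof. by apply: (addrI (tens 0 a)); rewrite -tensDl !addr0. Qed.

Lemma tens0r n (v : V) : tens v (0 : T n) = 0.
Proof. by apply: (addrI (tens v 0)); rewrite -tensDr !addr0. Qed.

Lemma tensBl n (v w : V) (a : T n) : tens (v - w) a = tens v a - tens w a.
Proof. by apply: (addIr (tens w a)); rewrite -tensDl !subrK. Qed.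

Lemma tensBr n (v : V) (a b : T n) : tens v (a - b) = tens v a - tens v b.
Proof. by apply: (addIr (tens v b)); rewrite -tensDr !subrK. Qed.

Lemma tens_suml n (I : Type) (s : seq I) (F : I -> V) (a : T n) :
  tens (\sum_(i <- s) F i) a = \sum_(i <- s) tens (F i) a.
Proof.
by elim/big_rec2: _ => [|i y1 y2 _ <-]; rewrite ?tens0l ?tensDl.
Qed.

Lemma norm_tens n (v : V) (a : T n) : `|tens v a| = `|v| * `|a|.
Proof.
apply/eqP; rewrite -(@eqrXn2 _ 2)// ?mulr_ge0//; apply/eqP.
by rewrite exprMn -!hdot_norm tens_dot.
Qed.

End tensor_products.

(** * Grids of step 1/(n+1) on the half-line *)

Section grids.
Context {R : realType}.
Implicit Types (n j N : nat) (t : R).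

(** With step 1/(n+1) each integer k >= 0 is a point of every grid, at index k * n.+1. *)
Definition gridpt n j : R := j%:R / n.+1%:R.
Definition gridindex n t : nat := Num.truncn (t * n.+1%:R).
Definition gridfloor n t : R := gridpt n (gridindex n t).

Lemma gridpt_ge0 n j : 0 <= gridpt n j.
Proof. by rewrite divr_ge0. Qed.

Lemma gridpt0 n : gridpt n 0 = 0.
Proof. by rewrite /gridpt mul0r. Qed.

Lemma gridpt_le n i j : (gridpt n i <= gridpt n j) = (i <= j)%N.
Proof. by rewrite ler_pM2r ?ler_nat// invr_gt0. Qed.

Lemma gridpt_end n N : gridpt n (N * n.+1) = N%:R.
Proof. by rewrite /gridpt natrM mulfK. Qed.

Lemma gridpt_leN n N j : (gridpt n j <= N%:R) = (j <= N * n.+1)%N.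
Proof. by rewrite -(gridpt_end n) gridpt_le. Qed.

Lemma gridptS n j : gridpt n j.+1 = gridpt n j + n.+1%:R^-1.
Proof. by rewrite /gridpt -natr1 mulrDl mul1r. Qed.

Lemma gridindex_itv n t : 0 <= t ->
  gridpt n (gridindex n t) <= t < gridpt n (gridindex n t).+1.
Proof.
move=> t0; have := @truncn_itv _ (t * n.+1%:R); rewrite mulr_ge0// => /(_ isT).
by rewrite /gridpt ler_pdivrMr// ltr_pdivlMr.
Qed.

Lemma gridindexP n t j : gridpt n j <= t < gridpt n j.+1 -> gridindex n t = j.
Proof.
move=> h; apply: truncn_def; move: h.
by rewrite /gridpt ler_pdivrMr// ltr_pdivlMr.
Qed.

Lemma gridpt_leE n t j : 0 <= t -> (gridpt n j <= t) = (j <= gridindex n t)%N.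
Proof.
move=> t0; rewrite /gridindex truncn_ge_nat ?mulr_ge0//.
by rewrite /gridpt ler_pdivrMr.
Qed.

Lemma gridindex_leN n t N : 0 <= t <= N%:R -> (gridindex n t <= N * n.+1)%N.
Proof.
move=> /andP[t0 tN]; rewrite -gridpt_leN.
by apply: le_trans tN; case/andP: (gridindex_itv n t0).
Qed.

Lemma le_gridindex n s t : s <= t -> (gridindex n s <= gridindex n t)%N.
Proof. by move=> st; apply: le_truncn; rewrite ler_wpM2r. Qed.

Lemma gridindex_pt n j : gridindex n (gridpt n j) = j.
Proof.
by apply: gridindexP; rewrite lexx gridptS ltrDl invr_gt0 /=.
Qed.

Lemma gridfloor_ge0 n t : 0 <= gridfloor n t. Proof. exact: gridpt_ge0. Qed.

Lemma gridfloor_le n t : 0 <= t -> gridfloor n t <= t.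
Proof. by move=> /(gridindex_itv n)/andP[]. Qed.

Lemma gridfloor_dist n t : 0 <= t -> `|gridfloor n t - t| < n.+1%:R^-1.
Proof.
move=> /(gridindex_itv n)/andP[]; rewrite gridptS -/(gridfloor n t) => h1 h2.
by rewrite distrC ger0_norm ?subr_ge0// ltrBlDl.
Qed.

Lemma gridfloor_in n t N : 0 <= t <= N%:R -> 0 <= gridfloor n t <= N%:R.
Proof.
by move=> tN; rewrite gridfloor_ge0 gridpt_leN gridindex_leN.
Qed.

(** The integer part of t is a grid point not exceeding t, hence not exceeding the left grid point
    of t. *)
Lemma floor_gridfloor n t : 0 <= t -> Num.floor (gridfloor n t) = Num.floor t.
Proof.
move=> t0; apply/eqP; rewrite floor_eq; apply/andP; split; last first.
  by apply: (le_lt_trans (gridfloor_le n t0)); exact: floorD1_gt.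
have : 0 <= Num.floor t by rewrite floor_ge0.
have := floor_le_tmp t; case: (Num.floor t) => // k kt _.
rewrite -pmulrn -(gridpt_end n k) gridpt_le -gridpt_leE// gridpt_end.
exact: kt.
Qed.

Lemma near_invS (e : R) : 0 < e -> exists n0, forall n, (n0 <= n)%N ->
  n.+1%:R^-1 < e.
Proof.
move=> e0; exists (Num.truncn e^-1) => n h.
rewrite invf_plt ?posrE//; apply: lt_le_trans (truncnS_gt _) _.
by rewrite ler_nat.
Qed.

End grids.

(** * Uniform continuity and approximation from left grid points on [0, N] *)

Section uniform_continuity.
Context {R : realType} {H : normedModType R} (N : nat).
Implicit Types (f : R -> H).

Definition ucont f := forall e : R, 0 < e -> exists2 dlt : R, 0 < dlt &
  forall s t, 0 <= s <= N%:R -> 0 <= t <= N%:R -> `|s - t| < dlt ->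
    `|f s - f t| < e.

(** The left grid point of t has the same integer part as t, so jumps at the integers are allowed:
    the degree-1 sawtooth component satisfies this but need not be continuous. *)
Definition grid_regular f := forall e : R, 0 < e -> exists n0 : nat,
  forall n, (n0 <= n)%N -> forall t, 0 <= t <= N%:R ->
    `|f (gridfloor n t) - f t| < e.

Lemma ucont_grid_regular f : ucont f -> grid_regular f.
Proof.
move=> uf e e0; have [dl dl0 h] := uf e e0.
have [n0 hn0] := near_invS dl0.
exists n0 => n nn t tN; apply: h => //; first exact: gridfloor_in.
case/andP: tN => t0 _.
by apply: lt_trans (gridfloor_dist n t0) _; exact: hn0.
Qed.

(** Heine's theorem. Compactness is used in near-covering form, along the filter of moduli [dl]
    tending to 0 from the right, so that one [dl] serves all points. *)
Lemma within_continuous_ucont f : {within `[0, N%:R], continuous f} -> ucont f.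
Proof.
move=> /subspace_continuousP cf e e0.
have /compact_near_coveringP := @segment_compact R 0 N%:R.
move=> /(_ R (0^'+) (fun dl s => forall t, 0 <= t <= N%:R -> `|s - t| < dl ->
  0 <= s <= N%:R -> `|f s - f t| < e)).
case=> [|r /= r0 hr].
- move=> x xN.
  have /cvgrPdist_lt/(_ (e / 2)) := cf x xN.
  rewrite divr_gt0//= => /(_ isT).
  rewrite -nbhs_nearE withinE /= => -[U /nbhs_ballP[r /= r0 hr] hU].
  have hb y : 0 <= y <= N%:R -> `|x - y| < r -> `|f x - f y| < e / 2.
    move=> yN xy; have : (U `&` `[0, N%:R]) y.
      by split; [exact: hr | rewrite /= in_itv].
    by rewrite -hU => -[].
  exists (ball x (r / 2), [set dl | 0 < dl < r / 2]).
    split => /=; first by apply: nbhsx_ballx; rewrite divr_gt0.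
    near=> z; apply/andP; split; near: z; first exact: nbhs_right_gt.
    by apply: nbhs_right_lt; rewrite divr_gt0.
  move=> [y dl] /= [xy /andP[dl0 dlr]] t tN yt yN.
  have {}xy : `|x - y| < r / 2 by [].
  have h1 : `|f x - f y| < e / 2 by apply: hb => //; lra.
  have h2 : `|f x - f t| < e / 2.
    apply: hb => //.
    by apply: (le_lt_trans (ler_distD y x t)); lra.
  apply: (le_lt_trans (ler_distD (f x) (f y) (f t))).
  by rewrite (distrC (f y)); lra.
- exists (r / 2); first by rewrite divr_gt0.
  move=> s t sN tN st; have := hr (r / 2).
  rewrite /ball_ /= sub0r normrN gtr0_norm ?divr_gt0// => /(_ _ isT).
  by move=> hh; apply: (hh _ s) => //; lra.
Unshelve. all: by end_near. Qed.

Lemma uniform_limit_ucont f (g : nat -> R -> H) :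
  (forall n, ucont (g n)) ->
  (forall e : R, 0 < e -> exists n, forall t, 0 <= t <= N%:R ->
    `|g n t - f t| < e) -> ucont f.
Proof.
move=> ug gf e e0; have e3 : 0 < e / 3 by rewrite divr_gt0.
have [n hn] := gf _ e3; have [dl dl0 hd] := ug n _ e3.
exists dl => // s t sN tN st.
have := hn s sN; have := hn t tN; have := hd s t sN tN st.
have := ler_distD (g n s) (f s) (f t); have := ler_distD (g n t) (g n s) (f t).
by rewrite (distrC (f s) (g n s)); lra.
Qed.

Lemma ucont_cst (c : H) : ucont (fun=> c).
Proof. by move=> e e0; exists 1 => // s t _ _ _; rewrite subrr normr0. Qed.

Lemma ucontD f g : ucont f -> ucont g -> ucont (fun t => f t + g t).
Proof.
move=> uf ug e e0; have e2 : 0 < e / 2 by rewrite divr_gt0.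
have [d1 d10 h1] := uf _ e2; have [d2 d20 h2] := ug _ e2.
exists (Num.min d1 d2); first by rewrite lt_min d10.
move=> s t sN tN; rewrite lt_min => /andP[st1 st2].
have := h1 s t sN tN st1; have := h2 s t sN tN st2.
rewrite opprD addrACA; have := ler_normD (f s - f t) (g s - g t); lra.
Qed.

Lemma ucont_sum (I : Type) (r : seq I) (F : I -> R -> H) :
  (forall i, ucont (F i)) -> ucont (fun t => \sum_(i <- r) F i t).
Proof.
move=> uF; elim: r => [|i r IH].
  by under eq_fun do rewrite big_nil; exact: ucont_cst.
by under eq_fun do rewrite big_cons; exact: ucontD.
Qed.

Lemma ucont_min f (c : R) : 0 <= c <= N%:R -> ucont f ->
  ucont (fun t => f (Num.min c t)).
Proof.
move=> /andP[c0 cN] uf e e0; have [dl dl0 h] := uf e e0; exists dl => // s t.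
move=> /andP[s0 sN] /andP[t0 tN] st; apply: h; rewrite ?le_min ?ge_min.
- by rewrite c0 s0 cN.
- by rewrite c0 t0 cN.
- apply: le_lt_trans st; rewrite /Num.min.
  case: ifP => a; case: ifP => b; rewrite ?subrr ?normr0//.
  + rewrite ler_norml; move/negbT: b; rewrite -leNgt => b.
    have ? : s - t <= `|s - t| by rewrite ler_norm.
    by apply/andP; split; lra.
  + rewrite ler_norml; move/negbT: a; rewrite -leNgt => a.
    have ? : t - s <= `|s - t| by rewrite distrC ler_norm.
    by apply/andP; split; lra.
Qed.

End uniform_continuity.


Lemma cauchy_seq_cvg {R : realType} {H : completeNormedModType R}
    (u : nat -> H) :
  (forall e : R, 0 < e -> exists n0 : nat, forall n m,
    (n0 <= n)%N -> (n0 <= m)%N -> `|u n - u m| < e) ->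
  exists l : H, u @ \oo --> l.
Proof.
move=> cu; have : cvg (u @ \oo); last by move=> ?; exists (lim (u @ \oo)).
apply/cauchy_cvgP/cauchy_exP => e e0; have [n0 h] := cu e e0.
by exists (u n0); exists n0 => // n /= nn; rewrite -ball_normE; exact: h.
Qed.

(** * Partitions of an interval *)

Section partitions.
Context {R : realType}.
Implicit Types (s : seq R) (t : R).

Lemma itv_partition_lt a t s i : itv_partition a t s -> (i < size s)%N ->
  nth t (a :: s) i < nth t (a :: s) i.+1.
Proof. by case=> /(pathP t) h _ si; exact: (h i si). Qed.

Lemma itv_partition_in (N : nat) t s i : 0 <= t <= N%:R ->
  itv_partition 0 t s -> (i <= size s)%N -> 0 <= nth t (0 :: s) i <= N%:R.
Proof.
move=> /andP[t0 tN] ps si; rewrite (itv_partition_nth_ge _ ps)//=.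
exact: le_trans (itv_partition_nth_le _ ps) tN.
Qed.

(** Equal cells of length t/(k+1) with 1/(k+1) < dlt/t; for t = 0 the empty partition. *)
Lemma fine_partition t (dlt : R) : 0 <= t -> 0 < dlt ->
  exists2 s, itv_partition 0 t s & forall i, (i < size s)%N ->
    nth t (0 :: s) i.+1 - nth t (0 :: s) i < dlt.
Proof.
move=> t0 d0; have [->|tn0] := eqVneq t 0; first by exists [::] => //; split.
have {t0 tn0}t0 : 0 < t by rewrite lt_def tn0.
have [k /(_ k (leqnn _)) hk] := near_invS (divr_gt0 d0 t0).
pose s := mkseq (fun i => t * gridpt k i.+1) k.+1.
have nthE i : (i <= k.+1)%N -> nth t (0 :: s) i = t * gridpt k i.
  case: i => [|i ik] /=; first by rewrite gridpt0 mulr0.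
  by rewrite nth_mkseq.
have sz : size s = k.+1 by rewrite size_mkseq.
exists s; last first.
  move=> i; rewrite sz => ik; rewrite !nthE// 1?ltnW//.
  rewrite -mulrBr gridptS addrAC subrr add0r -ltr_pdivlMl//.
  by rewrite mulrC.
split.
  apply/(pathP t) => i; rewrite sz => ik.
  change (nth t (0 :: s) i < nth t (0 :: s) i.+1).
  by rewrite !nthE// 1?ltnW// ltr_pM2l// gridptS ltrDl invr_gt0.
rewrite -nth_last; apply/eqP.
have -> : nth 0 s (size s).-1 = nth t s k.
  by rewrite sz /=; apply: set_nth_default; rewrite sz.
by rewrite nth_mkseq// /gridpt divff ?mulr1// pnatr_eq0.
Qed.

End partitions.

(** By monotonicity the indices with [b i] form a final segment [k, m), so the selected increments
    telescope; k = m when there are none. With [b i] saying that the i-th tag has passed c, this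
    evaluates the Stieltjes sums of the indicator of [c, oo). *)
Lemma telescope_indicator {W : zmodType} (b : nat -> bool) (z : nat -> W) m :
  (forall i, (i.+1 < m)%N -> b i -> b i.+1) ->
  exists k, [/\ (k <= m)%N, (k < m)%N -> b k,
    (0 < k)%N -> ~~ b k.-1 &
    \sum_(0 <= i < m) (if b i then z i.+1 - z i else 0) = z m - z k].
Proof.
elim: m => [|m IH] hb.
  by exists 0%N; split=> //; rewrite big_geq// subrr.
have [|k [km kb kb' e]] := IH; first by move=> i im; apply: hb; exact: ltnW.
have [bm|bm] := boolP (b m).
  exists k; split=> //; first exact: leqW.
    rewrite ltnS leq_eqVlt => /predU1P[->//|]; exact: kb.
  by rewrite big_nat_recr//= e bm addrC addrA subrK.
exists m.+1; split=> //; first by rewrite ltnn.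
rewrite big_nat_recr//= (negbTE bm) addr0 subrr big_nat big1// => i /andP[_ im].
have mono d : (i + d < m.+1)%N -> b i -> b (i + d)%N.
  elim: d => [|d IHd]; rewrite ?addn0// addnS => lt bi.
  by apply: hb => //; apply: IHd => //; exact: ltnW.
case: ifP => // /(mono (m - i)%N).
by rewrite subnKC ?(ltnW im)// (negbTE bm) => /(_ (ltnSn m)).
Qed.

(** * Riemann-Stieltjes integrals of grid regular functions *)

Section riemann_stieltjes.
Context {R : realType} {V : hilbertType R} (T : tensorPowers V) (N : nat).
Variables (x : R -> V) (F : R -> R).
Hypothesis xF : forall s t, 0 <= s -> s <= t -> t <= N%:R ->
  `|x t - x s| <= F t - F s.
Hypothesis ux : ucont N x.
Implicit Types (t : R) (n : nat).

Let sumRS n (f : R -> T n) t (s : seq R) (u : nat -> R) : T n.+1 :=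
  \sum_(0 <= i < size s)
    tens (x (nth t (0 :: s) i.+1) - x (nth t (0 :: s) i)) (f (u i)).

(** Through [xF] the control [F] takes the place of the total variation: its increments dominate
    those of x and telescope. *)
Lemma sumRS_dist n (f g : R -> T n) t s u (e : R) :
  0 <= t <= N%:R -> itv_partition 0 t s ->
  (forall i, (i < size s)%N ->
    nth t (0 :: s) i <= u i <= nth t (0 :: s) i.+1) ->
  (forall r, 0 <= r <= t -> `|f r - g r| <= e) ->
  `|sumRS f t s u - sumRS g t s u| <= e * (F t - F 0).
Proof.
move=> tN ps us fg; rewrite /sumRS -sumrB.
apply: le_trans (ler_norm_sum _ _ _) _.
have -> : F t - F 0 = \sum_(0 <= i < size s)
    (F (nth t (0 :: s) i.+1) - F (nth t (0 :: s) i)).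
  by rewrite telescope_sumr//= (itv_partition_nth_size _ ps).
rewrite mulr_sumr big_nat [leRHS]big_nat; apply: ler_sum => i /andP[_ si].
have /andP[i0 _] := itv_partition_in tN ps (ltnW si).
have /andP[_ i1N] := itv_partition_in tN ps si.
have lt := itv_partition_lt ps si.
have h := xF i0 (ltW lt) i1N.
rewrite -tensBr norm_tens mulrC; apply: ler_pM => //.
have /andP[u1 u2] := us i si; apply: fg.
rewrite (le_trans i0 u1)/=.
by apply: le_trans u2 _; exact: (itv_partition_nth_le _ ps).
Qed.

(** The two integrals are compared on one partition fine enough for both, tagged at its left end
    points. For f = g this is uniqueness; for two grid approximations of one function it is the
    Cauchy estimate. *)
Lemma is_RS_integral_dist n (f g : R -> T n) t (e : R) I J :
  0 <= t <= N%:R -> is_RS_integral x f 0 t I -> is_RS_integral x g 0 t J ->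
  (forall r, 0 <= r <= t -> `|f r - g r| <= e) ->
  `|I - J| <= e * (F t - F 0).
Proof.
move=> tN fI gJ fg; apply/ler_addgt0Pr => h h0.
have h2 : 0 < h / 2 by rewrite divr_gt0.
have [d1 d10 H1] := fI _ h2; have [d2 d20 H2] := gJ _ h2.
have [||s ps ms] := @fine_partition _ t (Num.min d1 d2).
- by case/andP: tN.
- by rewrite lt_min d10.
pose u i := nth t (0 :: s) i.
have us i : (i < size s)%N -> nth t (0 :: s) i <= u i <= nth t (0 :: s) i.+1.
  by move=> si; rewrite lexx ltW//; exact: itv_partition_lt.
have := H1 s u ps; have := H2 s u ps; cbv zeta.
move=> /(_ _)/wrap[i si|B2].
  by split; [exact: us|have := ms i si; rewrite lt_min => /andP[]].
move=> /(_ _)/wrap[i si|B1].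
  by split; [exact: us|have := ms i si; rewrite lt_min => /andP[]].
have B3 := sumRS_dist tN ps us fg.
rewrite -/(sumRS f t s u) in B1; rewrite -/(sumRS g t s u) in B2.
have B4 := ler_distD (sumRS f t s u) I J.
have B5 := ler_distD (sumRS g t s u) (sumRS f t s u) J.
by rewrite (distrC J) in B2; lra.
Qed.

Lemma RS_integralE n (f : R -> T n) t I : 0 <= t <= N%:R ->
  is_RS_integral x f 0 t I -> RS_integral x f 0 t = I.
Proof.
move=> tN fI; apply: xget_unique => // J fJ.
apply/eqP; rewrite -subr_eq0 -normr_le0 -(mul0r (F t - F 0)).
by apply: is_RS_integral_dist tN fJ fI _ => r _; rewrite subrr normr0.
Qed.

Lemma is_RS_integral_ext n (f g : R -> T n) t I : 0 <= t ->
  (forall r, 0 <= r <= t -> f r = g r) ->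
  is_RS_integral x f 0 t I -> is_RS_integral x g 0 t I.
Proof.
move=> t0 fg fI e e0; have [dl dl0 h] := fI e e0; exists dl => // s u ps p hp.
have := h s u ps hp; congr (`| _ - _ | < _).
rewrite big_nat [RHS]big_nat; apply: eq_bigr => i /andP[_ si]; congr tens.
have [/andP[u1 u2] _] := hp i si; apply: fg.
rewrite (le_trans _ u1) ?(itv_partition_nth_ge _ ps)//=; last exact: ltnW.
by rewrite (le_trans u2)// (itv_partition_nth_le _ ps).
Qed.

Lemma is_RS_integralD n (f g : R -> T n) t I J :
  is_RS_integral x f 0 t I -> is_RS_integral x g 0 t J ->
  is_RS_integral x (fun r => f r + g r) 0 t (I + J).
Proof.
move=> fI gJ e e0; have e2 : 0 < e / 2 by rewrite divr_gt0.
have [d1 d10 H1] := fI _ e2; have [d2 d20 H2] := gJ _ e2.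
exists (Num.min d1 d2); first by rewrite lt_min d10.
move=> s u ps p hp.
have := H1 s u ps; have := H2 s u ps; cbv zeta.
move=> /(_ _)/wrap[i si|B2].
  by have [? ] := hp i si; rewrite lt_min => /andP[].
move=> /(_ _)/wrap[i si|B1].
  by have [? ] := hp i si; rewrite lt_min => /andP[].
under eq_bigr do rewrite tensDr.
rewrite big_split/= opprD addrACA.
by apply: le_lt_trans (ler_normD _ _) _; rewrite /p; lra.
Qed.

Lemma is_RS_integral_sum n (K : nat) (f : nat -> R -> T n) t I :
  (forall i, is_RS_integral x (f i) 0 t (I i)) ->
  is_RS_integral x (fun r => \sum_(0 <= i < K) f i r) 0 t
    (\sum_(0 <= i < K) I i).
Proof.
move=> h; elim: K => [|K IH].
  rewrite big_geq//; under eq_fun do rewrite big_geq//.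
  move=> e e0; exists 1 => // s u ps p hp.
  by rewrite big1 ?subrr ?normr0// => i _; rewrite tens0r.
rewrite big_nat_recr//= (_ : (fun r => _) =
  fun r => \sum_(0 <= i < K) f i r + f K r); first exact: is_RS_integralD.
by apply/funext => r; rewrite big_nat_recr.
Qed.

Lemma is_RS_integral_cst n (h : T n) t :
  is_RS_integral x (fun=> h) 0 t (tens (x t - x 0) h).
Proof.
move=> e e0; exists 1 => // s u ps p hp.
rewrite -tens_suml telescope_sumr// {1}/p (itv_partition_nth_size _ ps) /p/=.
by rewrite subrr normr0.
Qed.

(** The cells whose tag has passed c contribute x t - x (p k), where p k is within one mesh of
    min(c, t); continuity of x concludes. *)
Lemma is_RS_integral_step n (h : T n) t c : 0 <= t <= N%:R -> 0 <= c <= N%:R ->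
  is_RS_integral x (fun r => if c <= r then h else 0) 0 t
    (tens (x t - x (Num.min c t)) h).
Proof.
move=> tN /andP[c0 cN] e e0; have /andP[t0 tN'] := tN.
have h0 : 0 < `|h| + 1 by rewrite ltr_wpDl.
have [dl dl0 hd] := ux (divr_gt0 e0 h0).
exists dl => // s u ps p hp.
have [|k [ks kb kb' E]] := @telescope_indicator _ (fun i => c <= u i)
    (x \o p) (size s).
  move=> i si cu; have [/andP[_ u2] _] := hp i (ltnW si).
  have [/andP[u3 _] _] := hp _ si.
  exact: (le_trans cu (le_trans u2 u3)).
have -> : \sum_(0 <= i < size s)
    tens (x (p i.+1) - x (p i)) (if c <= u i then h else 0) =
    tens (x t - x (p k)) h.
  rewrite [x t](_ : _ = (x \o p) (size s)); last first.
    by rewrite /= /p (itv_partition_nth_size _ ps).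
  rewrite -E tens_suml; apply: eq_bigr => i _ /=.
  by case: ifP; rewrite ?tens0r ?tens0l.
rewrite -tensBl opprB addrC addrA subrK norm_tens.
have pk : 0 <= p k <= N%:R by exact: itv_partition_in.
have pkt : p k <= t by exact: (itv_partition_nth_le _ ps).
suff : `|x (p k) - x (Num.min c t)| < e / (`|h| + 1).
  rewrite ltr_pdivlMr// => /(le_lt_trans _); apply.
  by rewrite ler_wpM2l// lerDl.
apply: hd => //; first by rewrite le_min c0 t0 ge_min cN.
(* The tag of cell k-1 lies before c, so this cell ends before c + dl. *)
have B1 : p k < c + dl.
  case: k ks kb kb' {E pk pkt} => [|k] ks _ kb'; first by rewrite /p/=; lra.
  have := kb' isT; rewrite -ltNge/= => uc.
  by have [/andP[u1 u2]] := hp k ks; lra.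
(* Either k is the last index and p k = t, or the tag of cell k is at least c and p k > c - dl. *)
have B2 : Num.min c t - dl < p k.
  move: ks; rewrite leq_eqVlt => /predU1P[kE|ks].
    rewrite kE /p (itv_partition_nth_size _ ps).
    have : Num.min c t <= t by rewrite ge_min lexx orbT.
    by lra.
  have := kb ks => cu; have [/andP[u1 u2]] := hp k ks.
  have : Num.min c t <= c by rewrite ge_min lexx.
  by lra.
rewrite ltr_norml; apply/andP; split; first by lra.
rewrite /Num.min; case: ifP => _; lra.
Qed.

(* The integral of the step function f \o gridfloor k, Abel-summed so that it
   depends on t only through values of x. *)
Definition gridRS n (f : R -> T n) k t : T n.+1 :=
  tens (x t - x 0) (f 0) + \sum_(0 <= j < N * k.+1)
    tens (x t - x (Num.min (gridpt k j.+1) t))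
      (f (gridpt k j.+1) - f (gridpt k j)).

(** Writes [f \o gridfloor k] as a finite combination of indicators of half-lines [c, oo), the
    functions that [is_RS_integral_step] integrates. *)
Lemma gridfloor_telescope {W : zmodType} (f : R -> W) k t : 0 <= t <= N%:R ->
  f (gridfloor k t) = f 0 + \sum_(0 <= j < N * k.+1)
    (if gridpt k j.+1 <= t then f (gridpt k j.+1) - f (gridpt k j) else 0).
Proof.
move=> tN; have /andP[t0 _] := tN; have le := gridindex_leN k tN.
rewrite (big_cat_nat (leq0n _) le)/= [X in _ + (_ + X)]big_nat.
rewrite [X in _ + (_ + X)]big1 ?addr0; last first.
  by move=> j /andP[kj _]; rewrite gridpt_leE// ltnNge kj.
rewrite big_nat; under eq_bigr => j /andP[_ jk] do rewrite gridpt_leE// jk.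
rewrite -big_nat (@telescope_sumr _ 0%N _ (fun j => f (gridpt k j)))//.
by rewrite gridpt0 addrC subrK.
Qed.

Lemma is_RS_integral_grid n (f : R -> T n) k t : 0 <= t <= N%:R ->
  is_RS_integral x (f \o gridfloor k) 0 t (gridRS f k t).
Proof.
move=> tN; have /andP[t0 tN'] := tN.
(* The second test is void inside the sum. It makes the summand 0 for later j, where [gridpt k j.+1]
   exceeds N: [is_RS_integral_sum] asks for an integral at every index. *)
pose g (r : R) := f 0 + \sum_(0 <= j < N * k.+1)
    (if (gridpt k j.+1 <= r) && (j.+1 <= N * k.+1)%N
     then f (gridpt k j.+1) - f (gridpt k j) else 0).
apply: (@is_RS_integral_ext _ g) => //.
  move=> r /andP[r0 rt]; rewrite /= (@gridfloor_telescope _ f k r).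
    rewrite /g; congr (_ + _); rewrite big_nat [RHS]big_nat.
    by apply: eq_bigr => j /andP[_ ->]; rewrite andbT.
  by rewrite r0 (le_trans rt).
apply: is_RS_integralD; first exact: is_RS_integral_cst.
rewrite (_ : \sum_(0 <= j < _) _ = \sum_(0 <= j < N * k.+1)
   (if (j.+1 <= N * k.+1)%N then tens (x t - x (Num.min (gridpt k j.+1) t))
      (f (gridpt k j.+1) - f (gridpt k j)) else 0)); last first.
  by rewrite big_nat [RHS]big_nat; apply: eq_bigr => j /andP[_ ->].
apply: is_RS_integral_sum => j.
have [jN|jN] := boolP (j < N * k.+1)%N.
  under eq_fun do rewrite andbT.
  by apply: is_RS_integral_step => //; rewrite gridpt_ge0 gridpt_leN.
rewrite -[X in is_RS_integral _ _ _ _ X](@tens0r _ _ T n (x t - x 0)).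
apply: (@is_RS_integral_ext _ (fun=> 0)) => // [r _|]; first by rewrite andbF.
exact: is_RS_integral_cst.
Qed.

Lemma control_ge0 t : 0 <= t <= N%:R -> 0 <= F t - F 0.
Proof. by move=> /andP[t0 tN]; apply: le_trans (xF (lexx 0) t0 tN). Qed.

Lemma control_le t : 0 <= t <= N%:R -> F t - F 0 <= F N%:R - F 0.
Proof.
move=> /andP[t0 tN]; rewrite lerD2r -subr_ge0.
exact: le_trans (xF t0 tN (lexx _)).
Qed.

(** The step functions [f \o gridfloor k] are uniformly Cauchy, hence so are their integrals,
    uniformly in t. The limit integrates f because a Stieltjes sum moves by at most e1 * C when f is
    replaced by its step function. *)
Lemma gridRS_unif_cvg n (f : R -> T n) : grid_regular N f ->
  exists2 I : R -> T n.+1,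
    (forall t, 0 <= t <= N%:R -> is_RS_integral x f 0 t (I t)) &
    forall e : R, 0 < e -> exists k0 : nat, forall k, (k0 <= k)%N ->
      forall t, 0 <= t <= N%:R -> `|gridRS f k t - I t| <= e.
Proof.
move=> gf; set C := F N%:R - F 0.
have C0 : 0 <= C by apply: control_ge0; rewrite lexx ler0n.
have C1 : 0 < C + 1 by rewrite ltr_wpDl.
have gf' (e : R) : 0 < e -> exists k0 : nat, forall k, (k0 <= k)%N ->
    exists2 e1 : R, e1 * C <= e & forall r, 0 <= r <= N%:R ->
    `|f (gridfloor k r) - f r| <= e1.
  move=> e0; have [k0 h] := gf _ (divr_gt0 e0 C1); exists k0 => k kk.
  exists (e / (C + 1)); last by move=> r rN; apply/ltW/h.
  by rewrite mulrAC ler_pdivrMr// ler_wpM2l ?lerDl// ltW.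
have dist (e : R) : 0 < e -> exists k0 : nat, forall k l, (k0 <= k)%N ->
    (k0 <= l)%N -> forall t, 0 <= t <= N%:R ->
    `|gridRS f k t - gridRS f l t| <= e.
  move=> e0; have e2 : 0 < e / 2 by rewrite divr_gt0.
  have [k0 h] := gf' _ e2; exists k0 => k l kk ll t tN.
  have [e1 ? h1] := h k kk; have [e3 ? h3] := h l ll.
  have e1p : 0 <= e1 by apply: le_trans (h1 0 _) => //; rewrite lexx ler0n.
  have e3p : 0 <= e3 by apply: le_trans (h3 0 _) => //; rewrite lexx ler0n.
  have := is_RS_integral_dist tN (is_RS_integral_grid f k tN)
    (is_RS_integral_grid f l tN) (e := e1 + e3).
  move=> /(_ _)/wrap[r /andP[r0 rt]|le].
    have rN : 0 <= r <= N%:R by rewrite r0 (le_trans rt)//; case/andP: tN.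
    apply: le_trans (ler_distD (f r) _ _) _.
    by apply: lerD; [exact: h1|rewrite distrC; exact: h3].
  apply: le_trans le _.
  have : (e1 + e3) * (F t - F 0) <= (e1 + e3) * C.
    by rewrite ler_wpM2l ?addr_ge0//; exact: control_le.
  by rewrite [X in _ <= X]mulrDl; lra.
have cvI t : 0 <= t <= N%:R -> exists l : T n.+1, gridRS f ^~ t @ \oo --> l.
  move=> tN; apply: (@cauchy_seq_cvg _ (T n.+1)) => e e0.
  have e2 : 0 < e / 2 by rewrite divr_gt0.
  have [k0 h] := dist _ e2; exists k0 => k l kk ll.
  by have := h k l kk ll t tN; lra.
pose I t := lim (gridRS f ^~ t @ \oo).
have cI t : 0 <= t <= N%:R -> gridRS f ^~ t @ \oo --> I t.
  by move=> tN; have [l hl] := cvI t tN; rewrite /I (cvg_lim _ hl).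
have unif (e : R) : 0 < e -> exists k0 : nat, forall k, (k0 <= k)%N ->
      forall t, 0 <= t <= N%:R -> `|gridRS f k t - I t| <= e.
  move=> e0; have [k0 h] := dist _ e0; exists k0 => k kk t tN.
  apply/ler_addgt0Pr => h' h0.
  have /cvgrPdist_lt/(_ _ h0) [l0 _ hl] := cI t tN.
  have := hl (maxn l0 k0) (leq_maxl _ _) => /= h1.
  have h2 := h k (maxn l0 k0) kk (leq_maxr _ _) t tN.
  have := ler_distD (gridRS f (maxn l0 k0) t) (gridRS f k t) (I t).
  by rewrite (distrC (gridRS f (maxn l0 k0) t) (I t)); lra.
exists I => // t tN e e0.
(* From I t to [gridRS], to the Stieltjes sum of the step function, to that of f: each passage costs
   at most e / 3. *)
have e3 : 0 < e / 3 by rewrite divr_gt0.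
have [k0 h0] := unif _ e3; have [k1 h1] := gf' _ e3.
pose k := maxn k0 k1.
have A1 := h0 k (leq_maxl _ _) t tN.
have [e1 A2 A3] := h1 k (leq_maxr _ _).
have [dl dl0 hd] := is_RS_integral_grid f k tN e3.
exists dl => // s u ps p hp.
have A4 := hd s u ps hp.
have A5 : `|sumRS (f \o gridfloor k) t s u - sumRS f t s u| <=
    e1 * (F t - F 0).
  apply: sumRS_dist => //; first by move=> i si; have [] := hp i si.
  move=> r /andP[r0 rt]; apply: A3; rewrite r0 (le_trans rt)//.
  by case/andP: tN.
have e1p : 0 <= e1 by apply: le_trans (A3 0 _) => //; rewrite lexx ler0n.
have A6 : e1 * (F t - F 0) <= e1 * C by rewrite ler_wpM2l//; exact: control_le.
rewrite -/(sumRS f t s u).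
rewrite -/(sumRS (f \o gridfloor k) t s u) in A4.
have A7 := ler_distD (gridRS f k t) (I t) (sumRS f t s u).
have A8 := ler_distD (sumRS (f \o gridfloor k) t s u)
  (gridRS f k t) (sumRS f t s u).
by rewrite (distrC _ (I t)) in A1; lra.
Qed.

(** After Abel summation t enters only through x t and x (min(c, t)), both continuous in t. *)
Lemma ucont_gridRS n (f : R -> T n) k : ucont N (gridRS f k).
Proof.
have utens c (h : T n) : 0 <= c <= N%:R ->
    ucont N (fun t => tens (x t - x (Num.min c t)) h).
  move=> cN e e0.
  have h0 : 0 < `|h| + 1 by rewrite ltr_wpDl.
  have e2 : 0 < e / (`|h| + 1) / 2 by rewrite !divr_gt0.
  have [d1 d10 H1] := ux e2; have [d2 d20 H2] := ucont_min cN ux e2.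
  exists (Num.min d1 d2); first by rewrite lt_min d10.
  move=> s t sN tN; rewrite lt_min => /andP[st1 st2].
  rewrite -tensBl norm_tens opprD opprK addrACA (addrC (- x (Num.min c s))).
  have B1 := H1 s t sN tN st1; have B2 := H2 s t sN tN st2.
  have B3 : `|x s - x t + (x (Num.min c t) - x (Num.min c s))| <
      e / (`|h| + 1).
    apply: le_lt_trans (ler_normD _ _) _.
    by rewrite (distrC (x (Num.min c t))); lra.
  move: B3; rewrite ltr_pdivlMr// => /(le_lt_trans _); apply.
  by rewrite ler_wpM2l// lerDl.
apply: ucontD.
  (* The boundary term is the case c = 0, since x 0 = x (min(0, t)) on [0, N]. *)
  have := utens 0 (f 0); rewrite lexx ler0n => /(_ isT) h e e0.
  have [dl dl0 hd] := h e e0; exists dl => // s t sN tN st.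
  have := hd s t sN tN st.
  by rewrite !min_l//; [case/andP: tN|case/andP: sN].
rewrite [X in ucont _ X](_ : _ = fun t => \sum_(0 <= j < N * k.+1)
   (if (j.+1 <= N * k.+1)%N then tens (x t - x (Num.min (gridpt k j.+1) t))
      (f (gridpt k j.+1) - f (gridpt k j)) else 0)); last first.
  apply/funext => t; rewrite big_nat [RHS]big_nat.
  by apply: eq_bigr => j /andP[_ ->].
apply: ucont_sum => j; have [jN|jN] := boolP (j < N * k.+1)%N;
  last exact: ucont_cst.
by apply: utens; rewrite gridpt_ge0 gridpt_leN.
Qed.

Lemma RS_integral_cvg n (f : R -> T n) t : grid_regular N f ->
  0 <= t <= N%:R -> gridRS f ^~ t @ \oo --> RS_integral x f 0 t.
Proof.
move=> gf tN; have [I hI cI] := gridRS_unif_cvg gf.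
rewrite (RS_integralE tN (hI t tN)); apply/cvgrPdist_le => e e0.
have [k0 h] := cI e e0; exists k0 => // k /= kk; rewrite distrC; exact: h.
Qed.

(** The integral is continuous even where f jumps, as a uniform limit of the continuous
    [gridRS f k]; only degree 1 of the sawtooth signature can jump. *)
Lemma ucont_RS_integral n (f : R -> T n) : grid_regular N f ->
  ucont N (fun t => RS_integral x f 0 t).
Proof.
move=> gf; have [I hI cI] := gridRS_unif_cvg gf.
apply: (@uniform_limit_ucont _ _ _ _ (gridRS f)); first exact: ucont_gridRS.
move=> e e0; have e2 : 0 < e / 2 by rewrite divr_gt0.
have [k0 h] := cI _ e2; exists k0 => t tN.
by rewrite (RS_integralE tN (hI t tN)); have := h k0 (leqnn _) t tN; lra.
Qed.

End riemann_stieltjes.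


(** * The total variation of a rectifiable path and its measure *)

Section total_variation_function.
Context {R : realType} {V : normedModType R} (N : nat) (x : R -> V).
Implicit Types (s t a b : R) (p : seq R).

Lemma vvariation_rcons a s t p : s < t -> itv_partition a s p ->
  itv_partition a t (rcons p t) /\
  vvariation a t x (rcons p t) = vvariation a s x p + `|x t - x s|.
Proof.
move=> st ps; have lastp : last a p = s by case: ps => _ /eqP.
split.
  case: ps => pp _; split; last by rewrite last_rcons.
  by rewrite rcons_path pp lastp.
rewrite /vvariation size_rcons big_nat_recr//=; congr (_ + `|x _ - x _|).
- rewrite big_nat [RHS]big_nat; apply: eq_bigr => i /andP[_ ip].
  rewrite -!rcons_cons !nth_rcons /= ip ltnS (ltnW ip).
  by rewrite (set_nth_default s)// (set_nth_default s t)//= ltnS ltnW.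
- by rewrite nth_rcons ltnn eqxx.
- rewrite -rcons_cons nth_rcons /= ltnSn -lastp.
  by rewrite (last_nth t).
Qed.

Hypothesis rx : rectifiable_path N x.

Local Notation F := (tv_function N x).

Lemma vvariations_neq0 t : 0 <= t -> vvariations 0 t x !=set0.
Proof.
rewrite le_eqVlt => /predU1P[<-|t0].
  by exists (vvariation 0 0 x [::]), [::] => //; split.
by exists (vvariation 0 t x [:: t]), [:: t] => //; exact: itv_partition1.
Qed.

Lemma vvariations_ubound t : 0 <= t <= N%:R ->
  has_ubound (vvariations 0 t x).
Proof.
move=> /andP[t0]; rewrite le_eqVlt => /predU1P[->|tN]; first by case: rx.
have [_ [M hM]] := rx; exists M => _ [p ps <-].
have [ps' e] := vvariation_rcons tN ps.
apply: le_trans (hM _ (ex_intro2 _ _ _ ps' erefl)).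
by rewrite e lerDl.
Qed.

Lemma tv_functionE t : 0 <= t <= N%:R -> F t = sup (vvariations 0 t x).
Proof.
move=> tN; rewrite /tv_function /vtotal_variation.
have -> : Num.min (Num.max t 0) N%:R = t.
  by rewrite max_l ?min_l//; case/andP: tN.
rewrite ereal_sup_EFin//; first exact: vvariations_ubound.
by apply: vvariations_neq0; case/andP: tN.
Qed.

Lemma vvariation_le t p : 0 <= t <= N%:R -> itv_partition 0 t p ->
  vvariation 0 t x p <= F t.
Proof.
move=> tN ps; rewrite tv_functionE//; apply: ub_le_sup.
  exact: vvariations_ubound.
by exists p.
Qed.

(** A partition of [0, s] extended by t gains |x t - x s|. So [F] can serve as the control in the
    Riemann-Stieltjes estimates. *)
Lemma tv_function_control s t : 0 <= s -> s <= t -> t <= N%:R ->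
  `|x t - x s| <= F t - F s.
Proof.
move=> s0; rewrite le_eqVlt => /predU1P[->|st] tN.
  by rewrite !subrr normr0.
have sN : 0 <= s <= N%:R by rewrite s0 (le_trans (ltW st)).
have tN' : 0 <= t <= N%:R by rewrite tN (le_trans s0)// ltW.
rewrite lerBrDr addrC -lerBrDr (tv_functionE sN).
apply: ge_sup; first exact: vvariations_neq0.
move=> _ [p ps <-]; have [ps' e] := vvariation_rcons st ps.
by rewrite lerBrDr -e; exact: vvariation_le.
Qed.

Lemma tv_function0 : F 0 = 0.
Proof.
rewrite tv_functionE ?lexx ?ler0n//.
rewrite (_ : vvariations _ _ _ = [set 0]) ?sup1//.
have v0 : vvariation 0 0 x [::] = 0 by rewrite /vvariation big_geq.
apply/seteqP; split => [_ [p /itv_partitionxx -> <-]//|_ ->].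
by exists [::] => //; split.
Qed.

Lemma le_tv_function s t : 0 <= s -> s <= t -> t <= N%:R -> F s <= F t.
Proof.
move=> s0 st tN; rewrite -subr_ge0.
exact: le_trans (tv_function_control s0 st tN).
Qed.

(** The grid is stopped at t: cells after t contribute 0 and the range of summation does not depend
    on t. *)
Definition grid_variation n t : R := \sum_(0 <= j < N * n.+1)
  `|x (Num.min (gridpt n j.+1) t) - x (Num.min (gridpt n j) t)|.

Lemma grid_variation_le n t : 0 <= t <= N%:R -> grid_variation n t <= F t.
Proof.
move=> /andP[t0 tN].
apply: (@le_trans _ _ (\sum_(0 <= j < N * n.+1)
  (F (Num.min (gridpt n j.+1) t) - F (Num.min (gridpt n j) t)))).
  apply: ler_sum => j _; apply: tv_function_control.
  - by rewrite le_min gridpt_ge0.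
  - by rewrite le_min ge_min gridpt_le leqnSn /= ge_min lexx orbT.
  - by rewrite ge_min tN orbT.
rewrite (@telescope_sumr _ 0%N _ (fun j => F (Num.min (gridpt n j) t)))//.
by rewrite gridpt_end gridpt0 min_r// min_l// tv_function0 subr0.
Qed.

(** Triangle inequality inside each block from q i to q i.+1. *)
Lemma sum_dist_subseq (y : nat -> V) (q : nat -> nat) m :
  (forall i, (i < m)%N -> (q i <= q i.+1)%N) ->
  \sum_(0 <= i < m) `|y (q i.+1) - y (q i)| <=
  \sum_(0 <= j < q m) `|y j.+1 - y j|.
Proof.
elim: m => [|m IH] qi; first by rewrite big_geq// sumr_ge0.
rewrite big_nat_recr//= [leRHS](big_cat_nat (leq0n (q m)) (qi m (ltnSn m)))/=.
apply: lerD.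
  by apply: IH => i im; apply: qi; exact: ltnW.
rewrite -(telescope_sumr y) ?qi//; exact: ler_norm_sum.
Qed.

(** A partition that nearly attains the supremum is rounded down to the grid. Continuity makes the
    rounding cheap, and the rounded points are a subsequence of the grid. *)
Lemma grid_variation_gt t (e : R) : 0 <= t <= N%:R -> 0 < e ->
  exists n0 : nat, forall n, (n0 <= n)%N -> F t - e < grid_variation n t.
Proof.
move=> tN e0; have /andP[t0 tN'] := tN.
have hs : has_sup (vvariations 0 t x).
  by split; [exact: vvariations_neq0|exact: vvariations_ubound].
have e2 : 0 < e / 2 by rewrite divr_gt0.
have [_ [p ps <-]] := sup_adherent e2 hs; rewrite -tv_functionE// => hp.
(* Rounding costs each of the m cells at most 2 e / (4 (m+1)), less than e / 2 in total; the other e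
   / 2 is the gap to the supremum. *)
pose m := size p; have m0 : 0 < 4 * m.+1%:R :> R by rewrite mulr_gt0.
have [c _] := rx; have /within_continuous_ucont c' := c.
have [dl dl0 hd] := c' _ (divr_gt0 e0 m0).
have [n0 hn] := near_invS dl0; exists n0 => n nn.
pose z i := nth t (0 :: p) i; pose q i := gridindex n (z i).
have zN i : (i <= m)%N -> 0 <= z i <= N%:R by exact: itv_partition_in.
have zt i : (i <= m)%N -> z i <= t.
  by move=> im; exact: (itv_partition_nth_le _ ps).
pose y j := x (Num.min (gridpt n j) t).
have close i : (i <= m)%N -> `|y (q i) - x (z i)| <= e / (4 * m.+1%:R).
  move=> im; have /andP[z0 _] := zN i im.
  rewrite /y min_l; last by apply: le_trans (zt i im); exact: gridfloor_le.
  apply/ltW/hd; [exact: gridfloor_in (zN i im)|exact: zN|].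
  exact: lt_trans (gridfloor_dist n z0) (hn n nn).
have qm : (q m <= N * n.+1)%N by apply: gridindex_leN; exact: zN.
have le1 : \sum_(0 <= j < q m) `|y j.+1 - y j| <= grid_variation n t.
  by rewrite /grid_variation (big_cat_nat (leq0n _) qm)/= lerDl sumr_ge0.
have := @sum_dist_subseq y q m; move=> /(_ _)/wrap[i im|le2].
  by apply: le_gridindex; apply/ltW; exact: itv_partition_lt ps im.
have le3 : vvariation 0 t x p <= \sum_(0 <= i < m)
    (`|y (q i.+1) - y (q i)| + 2 * (e / (4 * m.+1%:R))).
  rewrite /vvariation -/m big_nat [leRHS]big_nat.
  apply: ler_sum => i /andP[_ im] /=; rewrite -/(z i) -[nth _ p i]/(z i.+1).
  have h1 := close i (ltnW im); have h2 := close i.+1 im.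
  have h3 := ler_distD (y (q i.+1)) (x (z i.+1)) (x (z i)).
  rewrite (distrC (x (z i.+1)) (y _)) in h3.
  have h4 := ler_distD (y (q i)) (y (q i.+1)) (x (z i)).
  by move: h1 h2 h3 h4; set eta := e / _; lra.
have le4 : \sum_(0 <= i < m) (2 * (e / (4 * m.+1%:R))) <= e / 2.
  rewrite sumr_const_nat subn0 -[X in X <= _]mulr_natr.
  have -> : 2 * (e / (4 * m.+1%:R)) * m%:R = e / 2 * (m%:R / m.+1%:R).
    by field; rewrite addrC natr1 pnatr_eq0.
  by rewrite ler_piMr ?ltW// ltr_pdivrMr// mul1r ltr_nat.
rewrite big_split/= in le3.
by apply: lt_le_trans _ le1; lra.
Qed.

Lemma grid_variation_cvg t : 0 <= t <= N%:R ->
  grid_variation ^~ t @ \oo --> F t.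
Proof.
move=> tN; apply/cvgrPdist_lt => e e0.
have [n0 h] := grid_variation_gt tN e0; exists n0 => // n /= nn.
have := h n nn; have := grid_variation_le n tN => h1 h2.
by rewrite ger0_norm ?subr_ge0//; lra.
Qed.

(** On every cell the increment of x is at most that of [F], so on a single cell [F] exceeds it by
    at most the total deficit of the grid variation. This transfers continuity from x to [F]. *)
Lemma tv_function_cell n j a b : (j < N * n.+1)%N ->
  gridpt n j <= a -> a <= b -> b <= gridpt n j.+1 ->
  F b - F a <= F N%:R - grid_variation n N%:R + `|x b - x a|.
Proof.
move=> jN ja ab bj.
have jN' : gridpt n j.+1 <= N%:R :> R by rewrite gridpt_leN.
have j0 : 0 <= gridpt n j :> R by exact: gridpt_ge0.
have aN : a <= N%:R by apply: le_trans ab (le_trans bj jN').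
have bN : b <= N%:R by exact: le_trans bj jN'.
have a0 : 0 <= a by exact: le_trans ja.
have b0 : 0 <= b by exact: le_trans ab.
have minE i : (i <= N * n.+1)%N -> Num.min (gridpt n i) N%:R = gridpt n i :> R.
  by move=> iN; rewrite min_l// gridpt_leN.
pose G i := F (gridpt n i).
have step i : (i < N * n.+1)%N -> `|x (Num.min (gridpt n i.+1) N%:R) -
    x (Num.min (gridpt n i) N%:R)| <= G i.+1 - G i.
  move=> iN; rewrite !minE// 1?ltnW//; apply: tv_function_control.
  - exact: gridpt_ge0.
  - by rewrite gridpt_le.
  - by rewrite gridpt_leN.
have le1 : \sum_(0 <= i < j) `|x (Num.min (gridpt n i.+1) N%:R) -
    x (Num.min (gridpt n i) N%:R)| <= G j - G 0%N.
  rewrite -(telescope_sumr G)// big_nat [leRHS]big_nat.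
  by apply: ler_sum => i /andP[_ ij]; apply: step; exact: ltn_trans jN.
have le2 : \sum_(j.+1 <= i < N * n.+1) `|x (Num.min (gridpt n i.+1) N%:R) -
    x (Num.min (gridpt n i) N%:R)| <= G (N * n.+1)%N - G j.+1.
  rewrite -(telescope_sumr G)// big_nat [leRHS]big_nat.
  by apply: ler_sum => i /andP[_ iN]; exact: step.
rewrite /grid_variation (big_cat_nat (leq0n j) (ltnW jN))/= (big_ltn jN).
rewrite !minE// 1?ltnW//.
have h1 := tv_function_control j0 ja aN.
have h2 := tv_function_control b0 bj jN'.
have h3 := ler_distD (x b) (x (gridpt n j.+1)) (x (gridpt n j)).
have h4 := ler_distD (x a) (x b) (x (gridpt n j)).
move: le1 le2; rewrite /G gridpt_end gridpt0 tv_function0.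
by rewrite !subr0; lra.
Qed.

Lemma ucont_tv_function : ucont N F.
Proof.
move=> e e0; have e4 : 0 < e / 4 by rewrite divr_gt0.
have NN : 0 <= (N%:R : R) <= N%:R by rewrite lexx ler0n.
have [n0 /(_ n0 (leqnn _)) hn] := grid_variation_gt NN e4.
have [/within_continuous_ucont c _] := rx.
have [dl dl0 hd] := c _ e4.
(* As d is at most the grid step, [a, b] meets at most two cells; each costs e / 4 for the deficit
   and e / 4 for the increment of x. *)
pose d := Num.min dl n0.+1%:R^-1.
have d0 : 0 < d by rewrite lt_min dl0 invr_gt0/=.
have main a b : 0 <= a -> a <= b -> b <= N%:R -> b - a < d ->
    F b - F a < e.
  move=> a0 ab bN bad; have aN := le_trans ab bN.
  have {}xd s t : a <= s -> s <= t -> t <= b -> `|x t - x s| < e / 4.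
    move=> as' st tb; apply: hd.
    - by rewrite (le_trans a0 (le_trans as' st)) (le_trans tb).
    - by rewrite (le_trans a0 as') (le_trans st) ?(le_trans tb).
    - rewrite ger0_norm ?subr_ge0//.
      have : d <= dl by rewrite ge_min lexx.
      by lra.
  have ab' : b - a < n0.+1%:R^-1.
    by apply: lt_le_trans bad _; rewrite ge_min lexx orbT.
  have := gridindex_itv n0 a0; set j := gridindex n0 a => /andP[ja aj].
  (* Beyond the last cell, a = b = N. *)
  have [jN|Nj] := ltnP j (N * n0.+1)%N; last first.
    have : N%:R <= a by rewrite -(gridpt_end n0) (le_trans _ ja)// gridpt_le.
    move=> Na; have -> : b = a by lra.
    by rewrite subrr.
  have [bj|jb] := leP b (gridpt n0 j.+1).
    have := tv_function_cell jN ja ab bj.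
    by have := xd a b (lexx _) ab (lexx _); lra.
  have jN2 : (j.+1 < N * n0.+1)%N.
    rewrite ltn_neqAle jN andbT; apply/eqP => je.
    by move: jb; rewrite je gridpt_end ltNge bN.
  have bj2 : b <= gridpt n0 j.+2.
    rewrite gridptS; move: aj ab'; set u := n0.+1%:R^-1; lra.
  have := tv_function_cell jN ja (ltW aj) (lexx _).
  have := tv_function_cell jN2 (lexx _) (ltW jb) bj2.
  have := xd a _ (lexx _) (ltW aj) (ltW jb).
  have := xd _ b (ltW aj) (ltW jb) (lexx _).
  lra.
exists d => // s t /andP[s0 sN] /andP[t0 tN] st.
have [le_st|/ltW le_ts] := leP s t.
- rewrite distrC ger0_norm ?subr_ge0 ?le_tv_function//; apply: main => //.
  by apply: le_lt_trans st; rewrite distrC ler_norm.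
- rewrite ger0_norm ?subr_ge0 ?le_tv_function//; apply: main => //.
  by apply: le_lt_trans st; rewrite ler_norm.
Qed.

Lemma tv_function_clamp t : F t = F (Num.min (Num.max t 0) N%:R).
Proof.
rewrite /tv_function; congr (fine (vtotal_variation _ _ _)).
have c0 : 0 <= Num.min (Num.max t 0) N%:R by rewrite le_min le_max lexx orbT/=.
by rewrite (max_l c0) [RHS]min_l// ge_min lexx orbT.
Qed.

Lemma clamp_in t : 0 <= Num.min (Num.max t 0) N%:R <= N%:R.
Proof. by rewrite le_min le_max lexx orbT ler0n ge_min lexx orbT. Qed.

Lemma clamp_dist s t : `|Num.min (Num.max s 0) N%:R -
  Num.min (Num.max t 0) N%:R| <= `|s - t|.
Proof.
have h1 : s - t <= `|s - t| by exact: ler_norm.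
have h2 : t - s <= `|s - t| by rewrite distrC ler_norm.
have N0 : 0 <= N%:R :> R by [].
move: (N%:R : R) N0 => M N0.
rewrite ler_norml /Num.max; case: (ltP s 0) => ?; case: (ltP t 0) => ?;
  rewrite /Num.min; do 2 case: ltP => ?; apply/andP; split; lra.
Qed.

(** Selects the first branch of [tv_measure]. Monotonicity and continuity pass from [0, N] to the
    line because the clamp is monotone and 1-Lipschitz. *)
Lemma tv_function_cumulative : exists f : cumulative R R, f =1 F.
Proof.
have ndF : {homo F : s t / s <= t}.
  move=> s t st; rewrite tv_function_clamp (tv_function_clamp t).
  have /andP[s0 _] := clamp_in s; have /andP[_ tN] := clamp_in t.
  apply: le_tv_function => //.
  rewrite le_min !ge_min lexx orbT andbT.
  by rewrite ge_max !le_max st lexx !orbT.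
have cF : continuous F.
  move=> t; apply/cvgrPdist_lt => e e0.
  have [dl dl0 h] := ucont_tv_function e0.
  exists dl => //= s; rewrite /ball_ /= => ts.
  rewrite tv_function_clamp (tv_function_clamp s).
  apply: h; [exact: clamp_in|exact: clamp_in|].
  exact: le_lt_trans (clamp_dist t s) ts.
pose M := isCumulative.Build R _ R F ndF (right_continuousW cF).
by exists (HB.pack_for (cumulative R R) F M).
Qed.

Local Notation mu := (tv_measure N x).

Lemma tv_measure_oc a b : a <= b -> mu `]a, b]%classic = (F b - F a)%:E.
Proof.
move=> ab; rewrite /tv_measure; case: pselect => [p|]; last first.
  by have := tv_function_cumulative.
case: (cid p) => f /= fE.
rewrite /lebesgue_stieltjes_measure /measure_extension.
rewrite measurable_mu_extE/=; last exact: is_ocitv.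
by rewrite wlength_itv_bnd// -!fE EFinB.
Qed.

End total_variation_function.


(** * Simple functions and their pointwise limits *)

Section simple_functions.
Context d (S : measurableType d) (R : realType) (H : normedModType R).
Implicit Types (s t : S -> H).

(** The set A is arbitrary: its preimage is a finite union of fibres. *)
Lemma simple_function_preimage s (A : set H) :
  simple_function s -> measurable (s @^-1` A).
Proof.
move=> [fs ms].
have -> : s @^-1` A = \bigcup_(y in range s `&` A) s @^-1` [set y].
  apply/seteqP; split => [w Aw|w [y [_ Ay] /= sy]]; last by rewrite /= sy.
  by exists (s w) => //; split => //; exists w.
apply: fin_bigcup_measurable => [|y _]; last exact: ms.
by apply: sub_finite_set fs => y [].
Qed.

Lemma simple_function_cst (c : H) : simple_function (fun _ : S => c).
Proof.
split; last by move=> y; rewrite (preimage_cst c [set y]); case: ifP.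
apply: (@sub_finite_set _ _ [set c]); last exact: finite_set1.
by move=> y [w _ <-].
Qed.

Lemma simple_function_if (b : S -> bool) s t : measurable [set w | b w] ->
  simple_function s -> simple_function t ->
  simple_function (fun w => if b w then s w else t w).
Proof.
move=> mb ss st; split.
  apply: (@sub_finite_set _ _ (range s `|` range t)).
    move=> y [w _ <-]; case: ifP => _; [left|right]; by exists w.
  by rewrite finite_setU; split; [case: ss|case: st].
move=> y.
have -> : (fun w => if b w then s w else t w) @^-1` [set y] =
    ([set w | b w] `&` s @^-1` [set y]) `|`
    (~` [set w | b w] `&` t @^-1` [set y]).
  apply/seteqP; split => w /=; case: ifP => bw.
  - by left.
  - by right.
  - by case=> [[]|[]].
  - by case=> [[]|[]] //.
by apply: measurableU; apply: measurableI => //;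
  [exact: simple_function_preimage|exact: measurableC|
   exact: simple_function_preimage].
Qed.

Lemma simple_function_measurable (g : H -> R) s :
  simple_function s -> measurable_fun setT (g \o s).
Proof.
move=> ss _ B mB; rewrite setTI comp_preimage.
exact: simple_function_preimage.
Qed.

End simple_functions.

Lemma simple_function_op d (S : measurableType d) (R : realType)
    (H1 H2 H3 : normedModType R) (op : H1 -> H2 -> H3) (s : S -> H1)
    (t : S -> H2) :
  simple_function s -> simple_function t ->
  simple_function (fun w => op (s w) (t w)).
Proof.
move=> ss st; split.
  apply: (@sub_finite_set _ _ [set op a b | a in range s & b in range t]).
    by move=> y [w _ <-]; exists (s w); [exists w|exists (t w) => //; exists w].
  by apply: finite_image2; [case: ss|case: st].
move=> y.
have -> : (fun w => op (s w) (t w)) @^-1` [set y] =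
    \bigcup_(a in range s) (s @^-1` [set a] `&` t @^-1` [set b | op a b = y]).
  apply/seteqP; split => [w /= <-|w [a _ [/= <-]]//].
  by exists (s w) => //; exists w.
apply: fin_bigcup_measurable => [|a _]; first by case: ss.
by apply: measurableI; exact: simple_function_preimage.
Qed.

Section pointwise_simple_limits.
Context d (S : measurableType d) (R : realType).

(** Convergence everywhere, unlike in [strongly_measurable]: for the process, null sets are removed
    once, in [rectifiable_modification]. *)
Definition simple_limit (H : normedModType R) (f : S -> H) :=
  exists2 s : nat -> S -> H, forall n, simple_function (s n) &
    forall w, s ^~ w @ \oo --> f w.

(* For everywhere defined functions this is equivalent to being a pointwise
   limit of simple functions, and it visibly passes to pointwise limits. *)
Definition separably_measurable (H : normedModType R) (f : S -> H) :=
  (exists y : nat -> H, forall w (e : R), 0 < e -> exists k, `|f w - y k| < e)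
  /\ forall z : H, measurable_fun setT (fun w => `|f w - z|).

Lemma simple_function_separable (H : normedModType R) (s : S -> H) :
  simple_function s -> separably_measurable s.
Proof.
move=> ss; split; last first.
  by move=> z; exact: (simple_function_measurable (fun a => `|a - z|)).
have [/finite_seqP[r rE] _] := ss; exists (nth 0 r) => w e e0.
have : s w \in r.
  have : range s (s w) by exists w.
  by rewrite rE.
by move=> wr; exists (index (s w) r); rewrite nth_index// subrr normr0.
Qed.

Lemma separably_measurable_lim (H : normedModType R) (f : nat -> S -> H) g :
  (forall n, separably_measurable (f n)) ->
  (forall w, f ^~ w @ \oo --> g w) -> separably_measurable g.
Proof.
move=> mf fg; split.
  have /choice[y hy] : forall n, exists y : nat -> H, forall w (e : R), 0 < e ->
    exists k, `|f n w - y k| < e by move=> n; case: (mf n).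
  (* Countably many sequences merged into one, indexed by codes of pairs (n, k). *)
  exists (fun k => if @unpickle (nat * nat)%type k is Some p then y p.1 p.2
                   else 0) => w e e0.
  have e2 : 0 < e / 2 by rewrite divr_gt0.
  have /cvgrPdist_lt/(_ _ e2)[n _ /(_ n (leqnn _))/= hn] := fg w.
  have [k hk] := hy n w _ e2.
  exists (pickle (n, k)); rewrite pickleK /=.
  by apply: le_lt_trans (ler_distD (f n w) _ _) _; lra.
move=> z.
apply: (@measurable_fun_cvg _ _ _ _
  (fun n w => `|f n w - z|)).
  by move=> n; case: (mf n).
move=> w _; apply: cvg_norm; apply: cvgB; [exact: fg|exact: cvg_cst].
Qed.

Lemma separably_measurable_simple_limit (H : normedModType R) (f : S -> H) :
  separably_measurable f -> simple_limit f.
Proof.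
move=> [[y hy] mf].
(* [s n w] is the first point closest to f w among y 0, ..., y n; its distance to f w is a minimum
   of finitely many measurable functions. *)
pose fix s n : S -> H := match n with
  | 0%N => fun=> y 0%N
  | m.+1 => fun w =>
     if `|f w - y m.+1| < `|f w - s m w| then y m.+1 else s m w
  end.
have ms n : measurable_fun setT (fun w => `|f w - s n w|).
  elim: n => [|n IH] /=; first exact: mf.
  rewrite (_ : (fun w => _) = fun w =>
    Num.min `|f w - y n.+1| `|f w - s n w|).
    by apply: measurable_minr => //; exact: mf.
  by apply/funext => w; rewrite /Num.min; case: ifP.
have ss n : simple_function (s n).
  elim: n => [|n IH] /=; first exact: simple_function_cst.
  apply: simple_function_if => //; last exact: simple_function_cst.
  rewrite -[X in measurable X]setTI.
  exact: (measurable_fun_ltr (mf (y n.+1)) (ms n)).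
have le n k w : (k <= n)%N -> `|f w - s n w| <= `|f w - y k|.
  elim: n => [|n IH]; first by rewrite leqn0 => /eqP ->.
  rewrite leq_eqVlt => /predU1P[->|kn] /=.
    by case: ltP => // h; rewrite ltW.
  by case: ltP => [/ltW h|_]; [exact: le_trans h (IH kn)|exact: IH].
exists s => // w; apply/cvgrPdist_lt => e e0.
have [k hk] := hy w e e0; exists k => // n /= kn.
exact: le_lt_trans (le _ _ _ kn) hk.
Qed.

Lemma simple_limit_separable (H : normedModType R) (f : S -> H) :
  simple_limit f -> separably_measurable f.
Proof.
move=> [s ss sf]; apply: separably_measurable_lim sf => n.
exact: simple_function_separable.
Qed.

Lemma simple_limit_lim (H : normedModType R) (f : nat -> S -> H) g :
  (forall n, simple_limit (f n)) ->
  (forall w, f ^~ w @ \oo --> g w) -> simple_limit g.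
Proof.
move=> mf fg; apply: separably_measurable_simple_limit.
by apply: separably_measurable_lim fg => n; exact: simple_limit_separable.
Qed.

Lemma simple_limit_simple (H : normedModType R) (s : S -> H) :
  simple_function s -> simple_limit s.
Proof. by move=> ss; exists (fun=> s) => // w; exact: cvg_cst. Qed.

Lemma simple_limit_op (H1 H2 H3 : normedModType R) (op : H1 -> H2 -> H3) f g :
  (forall (u : nat -> H1) (v : nat -> H2) a b, u @ \oo --> a -> v @ \oo --> b ->
    (fun n => op (u n) (v n)) @ \oo --> op a b) ->
  simple_limit f -> simple_limit g -> simple_limit (fun w => op (f w) (g w)).
Proof.
move=> cop [s ss sf] [t st tg]; exists (fun n w => op (s n w) (t n w)).
  by move=> n; exact: simple_function_op.
by move=> w; apply: cop; [exact: sf|exact: tg].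
Qed.

Lemma simple_limit_cst (H : normedModType R) (c : H) :
  simple_limit (fun=> c).
Proof. by apply: simple_limit_simple; exact: simple_function_cst. Qed.

Lemma simple_limitD (H : normedModType R) (f g : S -> H) :
  simple_limit f -> simple_limit g -> simple_limit (fun w => f w + g w).
Proof. by apply: simple_limit_op => u v a b; exact: cvgD. Qed.

Lemma simple_limitB (H : normedModType R) (f g : S -> H) :
  simple_limit f -> simple_limit g -> simple_limit (fun w => f w - g w).
Proof.
by apply: (simple_limit_op (op := fun a b => a - b)) => u v a b; exact: cvgB.
Qed.

Lemma simple_limit_sum (H : normedModType R) (m : nat) (f : nat -> S -> H) :
  (forall i, (i < m)%N -> simple_limit (f i)) ->
  simple_limit (fun w => \sum_(0 <= i < m) f i w).
Proof.
elim: m => [|m IH] mf.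
  rewrite (_ : (fun w => _) = fun=> 0); first exact: simple_limit_cst.
  by apply/funext => w; rewrite big_geq.
rewrite (_ : (fun w => _) = fun w => \sum_(0 <= i < m) f i w + f m w).
  apply: simple_limitD; last exact: mf.
  by apply: IH => i im; apply: mf; exact: ltnW.
by apply/funext => w; rewrite big_nat_recr.
Qed.

Lemma simple_limit_norm (H : normedModType R) (f : S -> H) (c : H) :
  simple_limit f -> measurable_fun setT (fun w => `|f w - c|).
Proof. by move/simple_limit_separable => [_]. Qed.

Lemma measurable_simple_limit (c : S -> R) :
  measurable_fun setT c -> @simple_limit R^o c.
Proof.
move=> mc; apply: separably_measurable_simple_limit; split; last first.
  move=> z; apply: measurableT_comp => //.
  by apply: measurable_funB => //; exact: measurable_cst.
exists (fun k => if @unpickle rat k is Some q then ratr q else 0) => w e e0.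
have : c w - e < c w + e by lra.
move=> /rat_in_itvoo[q]; rewrite in_itv/= => /andP[q1 q2].
exists (pickle q); rewrite pickleK; rewrite ltr_norml; lra.
Qed.

Lemma simple_limit_measurable (c : S -> R) :
  @simple_limit R^o c -> measurable_fun setT c.
Proof.
move=> [s ss sc]; apply: (@measurable_fun_cvg _ _ _ _ s) => [n|w _].
  exact: (simple_function_measurable (H := R^o) idfun).
exact: sc.
Qed.

Lemma simple_limitZ (H : normedModType R) (c : S -> R) (f : S -> H) :
  measurable_fun setT c -> simple_limit f ->
  simple_limit (fun w => c w *: f w).
Proof.
move=> /measurable_simple_limit mc mf.
apply: (@simple_limit_op R^o H H (fun a b => a *: b)) => // u v a b.
exact: cvgZ.
Qed.

(** Polarisation, as the distances from f to fixed points are measurable. *)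
Lemma simple_limit_hdot (H : hilbertType R) (f : S -> H) (h : H) :
  simple_limit f -> measurable_fun setT (fun w => hdot (f w) h).
Proof.
move=> mf.
rewrite (_ : (fun w => _) = fun w =>
  2^-1 * (`|f w - (- h)| ^+ 2 - `|f w - 0| ^+ 2 - `|h| ^+ 2)).
  apply: measurable_funM; first exact: measurable_cst.
  apply: measurable_funB; last exact: measurable_cst.
  by apply: measurable_funB; apply: measurable_funX; exact: simple_limit_norm.
by apply/funext => w; rewrite opprK subr0 normD_sqr; field.
Qed.

Lemma simple_limit_tens (V : hilbertType R) (T : tensorPowers V) n
    (f : S -> V) (g : S -> T n) :
  simple_limit f -> simple_limit g -> simple_limit (fun w => tens (f w) (g w)).
Proof.
apply: (simple_limit_op (op := @tens _ _ T n)) => u v a b ua vb.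
apply/cvgrPdist_lt => e e0.
have va : (fun n => `|u n - a| * `|v n| + `|a| * `|v n - b|) @ \oo -->
    (0 : R).
  have h1 : (fun n => `|u n - a|) @ \oo --> (0 : R).
    rewrite -(normr0 V) -(subrr a).
    by apply: cvg_norm; apply: cvgB => //; exact: cvg_cst.
  have h2 : (fun n => `|v n - b|) @ \oo --> (0 : R).
    rewrite -(normr0 (T n)) -(subrr b).
    by apply: cvg_norm; apply: cvgB => //; exact: cvg_cst.
  have z : (0 : R) = 0 * `|b| + `|a| * 0 by rewrite mul0r mulr0 addr0.
  rewrite z; apply: cvgD; apply: cvgM => //; first exact: cvg_norm.
  exact: cvg_cst.
have /cvgrPdist_lt/(_ _ e0) := va; apply: filterS => k.
rewrite (distrC (tens a b)) sub0r normrN ger0_norm ?addr_ge0 ?mulr_ge0//.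
apply: le_lt_trans.
have -> : tens (u k) (v k) - tens a b = tens (u k - a) (v k) + tens a (v k - b).
  by rewrite tensBl tensBr addrA subrK.
by apply: le_trans (ler_normD _ _) _; rewrite !norm_tens.
Qed.

End pointwise_simple_limits.


(** * Almost everywhere equality under the integral *)

Section integral_ae_eq_nonmeasurable.
Context d (S : measurableType d) (R : realType).
Variable mu : {measure set S -> \bar R}.
Local Open Scope ereal_scope.
Import HBNNSimple.

(** The integral is a supremum over simple functions below f. Cutting such a function off on the
    null set keeps its integral and places it below g. *)
Let le_integral_ae_eq (D : set S) (f g : S -> \bar R) :
  (forall x, D x -> 0 <= f x) -> (forall x, D x -> 0 <= g x) ->
  {ae mu, forall x, D x -> f x = g x} ->
  \int[mu]_(x in D) f x <= \int[mu]_(x in D) g x.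
Proof.
move=> f0 g0 [N [mN N0 fg]].
rewrite (ge0_integralE _ f0) (ge0_integralE _ g0).
apply: ge_ereal_sup => _ [h /= hf <-].
have -> : sintegral mu h = sintegral mu (proj_nnsfun h (measurableC mN)).
  rewrite -[in LHS](patch_setT (fun=> 0%R) h).
  rewrite -(@integral_nnsfun _ _ _ mu _ measurableT).
  rewrite -[in RHS](patch_setT (fun=> 0%R) (proj_nnsfun _ _)).
  rewrite -(@integral_nnsfun _ _ _ mu _ measurableT).
  apply: ge0_ae_eq_integral => //.
  - exact/measurable_EFinP.
  - exact/measurable_EFinP.
  - by move=> x _; rewrite lee_fin.
  - by move=> x _; rewrite lee_fin.
  exists N; split => // x /= /not_implyP[_]; apply: contra_notP => Nx.
  by rewrite mindicE mem_set ?mulr1.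
apply: ereal_sup_ubound; exists (proj_nnsfun h (measurableC mN)) => //= x.
rewrite mindicE.
have [Nx|Nx] := pselect (N x).
  rewrite memNset ?mulr0; last by move=> /=; exact.
  by rewrite /patch; case: ifPn => // /set_mem; exact: g0.
rewrite mem_set// mulr1; apply: le_trans (hf x) _.
rewrite /patch; case: ifPn => // /set_mem Dx.
suff -> : f x = g x by [].
by apply: contrapT => fgx; apply/Nx/fg => /= /(_ Dx).
Qed.

(* The library versions require measurability, which the random variables here
   only have after modification on a null set. *)
Lemma ge0_integral_ae_eq (D : set S) (f g : S -> \bar R) :
  (forall x, D x -> 0 <= f x) -> (forall x, D x -> 0 <= g x) ->
  {ae mu, forall x, D x -> f x = g x} ->
  \int[mu]_(x in D) f x = \int[mu]_(x in D) g x.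
Proof.
move=> f0 g0 fg; apply/eqP; rewrite eq_le !le_integral_ae_eq//.
by apply: filterS fg => x h /h.
Qed.

End integral_ae_eq_nonmeasurable.

(** * Bochner integrals in a Hilbert space, tested against vectors *)

Lemma hdot_inj {R : realType} {H : hilbertType R} (a b : H) :
  (forall h, hdot a h = hdot b h) -> a = b.
Proof.
move=> ab; apply/eqP; rewrite -subr_eq0 -normr_eq0 -sqrf_eq0 -hdot_norm.
by rewrite hdotBl ab subrr.
Qed.

Lemma cvg_dist_le {R : realType} {H : normedModType R} (u : nat -> H) (l : H)
    (r : nat -> R) :
  (forall n, `|u n - l| <= r n) -> r @ \oo --> 0 -> u @ \oo --> l.
Proof.
move=> ur r0; apply/cvgrPdist_lt => e e0.
have /cvgrPdist_lt/(_ _ e0) := r0; apply: filterS => n.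
rewrite sub0r normrN distrC => rn.
by apply: le_lt_trans (ur n) _; apply: le_lt_trans rn; exact: ler_norm.
Qed.

Lemma cvg_hdot {R : realType} {H : hilbertType R} (u : nat -> H) (l h : H) :
  u @ \oo --> l -> (fun n => hdot (u n) h) @ \oo --> hdot l h.
Proof.
move=> ul; apply: (@cvg_dist_le _ R^o _ _ (fun n => `|u n - l| * `|h|)).
  by move=> n; rewrite -hdotBl; exact: hdot_le.
have z : (0 : R) = 0 * `|h| by rewrite mul0r.
rewrite [X in _ --> X]z; apply: cvgM; last exact: cvg_cst.
rewrite -(normr0 H) -(subrr l).
by apply: cvg_norm; apply: cvgB => //; exact: cvg_cst.
Qed.

Section bochner_integrals.
Context d (S : measurableType d) (R : realType) (H : hilbertType R).
Variables (mu : {measure set S -> \bar R}) (D : set S).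
Hypotheses (mD : measurable D) (muD : (mu D < +oo)%E).

Local Notation integr f := (mu.-integrable D (EFin \o f)).

Lemma integr_cst (c : R) : integr (fun=> c).
Proof.
apply: measurable_bounded_integrable => //.
exact: bounded_cst.
Qed.

Lemma integrZl (c : R) (f : S -> R) : integr f -> integr (fun x => c * f x).
Proof. by move=> fi; exact: (integrableZl mD c fi). Qed.

Lemma Rintegral_sum (I : Type) (r : seq I) (f : I -> S -> R) :
  (forall i, integr (f i)) ->
  integr (fun x => \sum_(i <- r) f i x) /\
  \int[mu]_(x in D) (\sum_(i <- r) f i x) =
  \sum_(i <- r) \int[mu]_(x in D) f i x.
Proof.
move=> fi; elim: r => [|i r [IH1 IH2]].
  rewrite big_nil (_ : (fun x => _) = fun=> 0); last first.
    by apply/funext => x; rewrite big_nil.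
  by split; [exact: integr_cst|rewrite Rintegral_cst// mul0r].
rewrite big_cons (_ : (fun x => _) = fun x => f i x + \sum_(j <- r) f j x).
  split; last by rewrite RintegralD// IH2.
  exact: (integrableD mD (fi i) IH1).
by apply/funext => x; rewrite big_cons.
Qed.

Lemma simple_function_Rintegral (s : S -> H) (g : H -> R) :
  simple_function s -> integr (g \o s) /\
  \int[mu]_(x in D) g (s x) =
  \sum_(y \in range s) g y * fine (mu (D `&` s @^-1` [set y])).
Proof.
move=> ss; have [fs ms] := ss.
rewrite fsbig_finite//; set r := finmap.enum_fset (fset_set (range s)).
have rep : (g \o s) = fun x => \sum_(y <- r) g y * \1_(s @^-1` [set y]) x.
  apply/funext => x /=.
  have sr : s x \in r.
    rewrite (in_fset_set fs); apply/mem_set; by exists x.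
  rewrite (bigD1_seq (s x))//=; last exact: finmap.fset_uniq.
  rewrite indicE mem_set ?mulr1//= big1 ?addr0// => y yx.
  by rewrite indicE memNset ?mulr0//= => sxy; rewrite sxy eqxx in yx.
have i1 y : integr (\1_(s @^-1` [set y]) : S -> R).
  apply: measurable_bounded_integrable => //.
  exists 1; split => // M M1 x _ /=.
  rewrite ger0_norm ?indic_ge0//; apply: le_trans (ltW M1).
  by rewrite indicE; case: (_ \in _).
have i2 y : integr (fun x => g y * \1_(s @^-1` [set y]) x).
  exact: integrZl.
have [h1 h2] := Rintegral_sum r i2.
rewrite rep; split => //.
rewrite (_ : \int[mu]_(x in D) g (s x) = \int[mu]_(x in D) (g \o s) x)// rep.
rewrite h2; apply: eq_bigr => y _; rewrite RintegralZl//; congr (_ * _).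
by rewrite /Rintegral integral_indic// setIC.
Qed.

Lemma simple_integral_hdot (s : S -> H) h : simple_function s ->
  hdot (simple_integral mu D s) h = \int[mu]_(x in D) hdot (s x) h.
Proof.
move=> ss; have [_ ->] := simple_function_Rintegral (fun y => hdot y h) ss.
have [fs _] := ss; rewrite /simple_integral !fsbig_finite// hdot_suml.
by apply: eq_bigr => y _; rewrite hdotZl mulrC.
Qed.

Lemma integr_norm_le (f : S -> R) (g : S -> R) :
  measurable_fun D f -> (forall x, D x -> `|f x| <= g x) -> integr g ->
  integr f.
Proof.
move=> mf fg; apply: le_integrable => //; first exact/measurable_EFinP.
move=> x Dx; rewrite /= lee_fin; apply: le_trans (fg x Dx) _.
exact: ler_norm.
Qed.

Lemma integrD (f g : S -> R) : integr f -> integr g ->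
  integr (fun x => f x + g x).
Proof. by move=> fi gi; exact: (integrableD mD fi gi). Qed.

Variable f : S -> H.
Hypotheses (mf : simple_limit f) (fi : integr (fun x => `|f x|)).

Lemma measurable_norm_subr (s : S -> H) : simple_limit s ->
  measurable_fun D (fun x => `|f x - s x|).
Proof.
move=> ms; apply: measurable_funTS.
have := simple_limit_norm 0 (simple_limitB mf ms).
by under eq_fun do rewrite subr0.
Qed.

Lemma integr_norm_subr (s : S -> H) : simple_function s ->
  integr (fun x => `|f x - s x|).
Proof.
move=> ss; have [si _] := simple_function_Rintegral (fun y => `|y|) ss.
apply: (integr_norm_le (g := fun x => `|f x| + `|s x|)).
- by apply: measurable_norm_subr; exact: simple_limit_simple.
- by move=> x _; rewrite normr_id; exact: ler_normB.
- exact: integrD.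
Qed.

Lemma integr_hdot h : integr (fun x => hdot (f x) h).
Proof.
apply: (integr_norm_le (g := fun x => `|f x| * `|h|)).
- by apply: measurable_funTS; exact: simple_limit_hdot.
- by move=> x _; exact: hdot_le.
- by under eq_fun do rewrite mulrC; exact: integrZl.
Qed.

(** The error is proportional to |h|; taking for h the vector to be estimated turns this into a norm
    bound. *)
Lemma simple_integral_dist (s : S -> H) h : simple_function s ->
  `|hdot (simple_integral mu D s) h - \int[mu]_(x in D) hdot (f x) h| <=
  `|h| * \int[mu]_(x in D) `|f x - s x|.
Proof.
move=> ss; rewrite simple_integral_hdot//.
have [si _] := simple_function_Rintegral (fun y => hdot y h) ss.
have fhi := integr_hdot h; have fsi := integr_norm_subr ss.
rewrite -RintegralB//.
have di : integr (fun x => hdot (s x) h - hdot (f x) h).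
  exact: (integrableB mD si fhi).
apply: le_trans (le_normr_Rintegral mD di) _.
rewrite -RintegralZl//; apply: le_Rintegral => //.
- exact: integrable_norm.
- exact: integrZl.
- move=> x _; rewrite -hdotBl mulrC distrC; exact: hdot_le.
Qed.

(** Scalar products determine a vector, so this yields uniqueness of the Bochner integral. *)
Lemma bochner_integral_hdot I : is_bochner_integral mu D f I ->
  forall h, hdot I h = \int[mu]_(x in D) hdot (f x) h.
Proof.
move=> [s [ss _ si sI]] h.
have h1 := @cvg_hdot _ _ _ _ h sI.
suff h2 : (fun n => hdot (simple_integral mu D (s n)) h) @ \oo -->
    \int[mu]_(x in D) hdot (f x) h.
  exact: (cvg_unique _ h1 h2).
apply: (@cvg_dist_le _ R^o _ _
  (fun n => `|h| * \int[mu]_(x in D) `|f x - s n x|)).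
  by move=> n; apply: simple_integral_dist; case: (ss n).
have z : (0 : R) = `|h| * 0 by rewrite mulr0.
rewrite [X in _ --> X]z; apply: cvgM; first exact: cvg_cst.
by move/fine_cvgP: si => [].
Qed.

Lemma bochner_integral_exists : exists I, is_bochner_integral mu D f I.
Proof.
have [s ss sf] := mf.
(* Truncation makes 2 |f| + 1 a dominating function. The margin 1 ensures that t n x = s n x for
   large n, also where f vanishes. *)
pose t n x := if `|s n x| <= `|f x| + 1 then s n x else 0.
have mnf : measurable_fun setT (fun x => `|f x|).
  by have := simple_limit_norm 0 mf; under eq_fun do rewrite subr0.
have st n : simple_function (t n).
  apply: simple_function_if => //; last exact: simple_function_cst.
  rewrite -[X in measurable X]setTI.
  apply: (@measurable_fun_ler _ _ _ setT (fun x => `|s n x|)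
    (fun x => `|f x| + 1)) => //.
    exact: (simple_function_measurable (fun y => `|y|)).
  by apply: measurable_funD => //; exact: measurable_cst.
have tf x : t ^~ x @ \oo --> f x.
  apply/cvgrPdist_lt => e e0.
  have /cvgrPdist_lt h := sf x.
  have := h _ e0; have := h _ (ltr01 : 0 < 1 :> R).
  apply: filterS2 => n h1 h2; rewrite /t ifT//.
  have := ler_normB (f x) (f x - s n x).
  by rewrite subKr; move: h1; lra.
have dom n x : `|f x - t n x| <= 2 * `|f x| + 1.
  have := ler_normB (f x) (t n x); rewrite /t; case: ifP; first by lra.
  by rewrite normr0; have := normr_ge0 (f x); lra.
have gi : integr (fun x => 2 * `|f x| + 1).
  apply: integrD; last exact: integr_cst.
  exact: integrZl.
have ft0 : (\int[mu]_(x in D) (`|f x - t n x|)%:E)%E @[n --> \oo] --> 0%E.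
  have := @dominated_convergence _ _ _ mu D mD
    (fun n x => (`|f x - t n x|)%:E) (cst 0%E)
    (EFin \o (fun x => 2 * `|f x| + 1)).
  case=> //.
  - move=> n; apply/measurable_EFinP; apply: measurable_norm_subr.
    exact: simple_limit_simple.
  - apply: aeW => x _; apply: cvg_EFin; first by near=> n.
    rewrite -(normr0 H) -(subrr (f x)).
    by apply: cvg_norm; apply: cvgB => //; exact: cvg_cst.
  - by apply: aeW => x n _ /=; rewrite lee_fin normr_id.
  - by move=> _ _; rewrite integral0.
have /fine_cvgP[_ ft0'] := ft0.
have [I hI] : exists I : H, (fun n => simple_integral mu D (t n)) @ \oo --> I.
  apply: (@cauchy_seq_cvg _ H) => e e0.
  have e2 : 0 < e / 2 by rewrite divr_gt0.
  have /cvgrPdist_lt/(_ _ e2)[n0 _ hn0] := ft0'.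
  exists n0 => n m nn mm.
  (* The difference is tested against itself: |h|^2 is at most |h| times the sum of the two L1
     errors. *)
  set h := _ - _.
  have A1 := simple_integral_dist h (st n).
  have A2 := simple_integral_dist h (st m).
  have B1 := hn0 n nn; have B2 := hn0 m mm.
  rewrite /= sub0r normrN in B1; rewrite /= sub0r normrN in B2.
  rewrite -[fine _]/(\int[mu]_(x in D) `|f x - t n x|) in B1.
  rewrite -[fine _]/(\int[mu]_(x in D) `|f x - t m x|) in B2.
  have hh : `|h| ^+ 2 <= `|h| * (\int[mu]_(x in D) `|f x - t n x| +
      \int[mu]_(x in D) `|f x - t m x|).
    rewrite -hdot_norm {1}/h hdotBl mulrDr.
    have A3 := le_trans (ler_norm _) A1.
    by rewrite distrC in A2; have := le_trans (ler_norm _) A2; lra.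
  have [->|h0] := eqVneq h 0; first by rewrite normr0.
  move: hh; rewrite expr2 ler_pM2l ?normr_gt0// => /le_lt_trans; apply.
  have := ler_norm (\int[mu]_(x in D) `|f x - t n x|).
  have := ler_norm (\int[mu]_(x in D) `|f x - t m x|).
  lra.
exists I, t; split => //.
- move=> n; split => // y _; apply: le_lt_trans muD.
  apply: le_measure; rewrite ?inE//.
  by apply: measurableI => //; exact: simple_function_preimage.
- by apply: aeW => x _; exact: tf.
Unshelve. all: by end_near. Qed.

End bochner_integrals.

Section bochner_ae.
Context d (S : measurableType d) (R : realType) (H : hilbertType R).
Variables (mu : {measure set S -> \bar R}) (D : set S).
Hypotheses (mD : measurable D) (muD : (mu D < +oo)%E).

Lemma is_bochner_integral_ae_eq (f g : S -> H) I :
  {ae mu, forall x, D x -> f x = g x} ->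
  is_bochner_integral mu D f I -> is_bochner_integral mu D g I.
Proof.
move=> fg [s [ss sf si sI]]; exists s; split => //.
  by apply: filterS2 fg sf => x fgx sx Dx; rewrite -(fgx Dx); exact: sx.
rewrite (_ : (fun n => _) =
  fun n => (\int[mu]_(x in D) (`|f x - s n x|)%:E)%E)//.
apply/funext => n; apply: ge0_integral_ae_eq => //.
by apply: filterS fg => x fgx Dx; rewrite fgx.
Qed.

(** Covers functions g that agree with a simple limit only almost everywhere, as those built from
    the process itself do. *)
Lemma bochner_integralE (f g : S -> H) : simple_limit f ->
  mu.-integrable D (EFin \o (fun x => `|f x|)) ->
  {ae mu, forall x, D x -> f x = g x} ->
  forall h, hdot (bochner_integral mu D g) h = \int[mu]_(x in D) hdot (f x) h.
Proof.
move=> mf fi fg h.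
have [I fI] := bochner_integral_exists mD muD mf fi.
have gI := is_bochner_integral_ae_eq fg fI.
have -> : bochner_integral mu D g = I; last exact: bochner_integral_hdot.
apply: xget_unique => // J gJ.
have fJ : is_bochner_integral mu D f J.
  by apply: is_bochner_integral_ae_eq gJ; apply: filterS fg => x h' /h'.
by apply: hdot_inj => h'; rewrite !(bochner_integral_hdot mD muD mf fi).
Qed.

End bochner_ae.


(** * Integrals of grid regular functions against |dx| *)

Section grid_regularity.
Context {R : realType} (N : nat).

Lemma grid_regular_lipschitz {H K : normedModType R} (f : R -> H) (g : R -> K)
    (M : R) : grid_regular N f ->
  (forall s t, 0 <= s <= N%:R -> 0 <= t <= N%:R ->
    `|g s - g t| <= M * `|f s - f t|) -> grid_regular N g.
Proof.
move=> gf fg e e0.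
have M0 : 0 < `|M| + 1 by rewrite ltr_wpDl.
have [n0 h] := gf _ (divr_gt0 e0 M0); exists n0 => n nn t tN.
have := h n nn t tN; rewrite ltr_pdivlMr// => ht.
apply: le_lt_trans (fg _ _ _ _) _ => //; first exact: gridfloor_in.
apply: le_lt_trans ht; rewrite mulrC ler_wpM2l//.
by have := ler_norm M; lra.
Qed.

(** Every value is within 1 of one of the finitely many values on a fixed grid. *)
Lemma grid_regular_bounded {H : normedModType R} (f : R -> H) :
  grid_regular N f -> exists M : R, forall t, 0 <= t <= N%:R -> `|f t| <= M.
Proof.
move=> gf; have [n /(_ n (leqnn _)) h] := gf _ ltr01.
exists (\sum_(0 <= j < (N * n.+1).+1) `|f (gridpt n j)| + 1) => t tN.
have h1 := h t tN.
have h2 : `|f (gridfloor n t)| <=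
    \sum_(0 <= j < (N * n.+1).+1) `|f (gridpt n j)|.
  rewrite (bigD1_seq (gridindex n t)) ?iota_uniq//=; last first.
    by rewrite mem_index_iota /= ltnS gridindex_leN.
  by rewrite lerDl sumr_ge0.
have := ler_normB (f (gridfloor n t)) (f (gridfloor n t) - f t).
by rewrite subKr; lra.
Qed.

Lemma grid_regular_norm {H : normedModType R} (f : R -> H) :
  grid_regular N f -> @grid_regular R R^o N (fun t => `|f t|).
Proof.
move=> gf; apply: (grid_regular_lipschitz (M := 1)) gf _ => s t _ _.
by rewrite mul1r; exact: ler_dist_dist.
Qed.

Lemma grid_regular_normsq {H : normedModType R} (f : R -> H) :
  grid_regular N f -> @grid_regular R R^o N (fun t => `|f t| ^+ 2).
Proof.
move=> gf; have [M hM] := grid_regular_bounded gf.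
(* Squaring is Lipschitz on [-M, M] with constant 2 M. *)
apply: (grid_regular_lipschitz (M := M + M)) gf _ => s t sN tN.
rewrite subr_sqr normrM mulrC.
apply: ler_pM => //; last exact: ler_dist_dist.
by rewrite ger0_norm ?addr_ge0// lerD ?hM.
Qed.

Lemma grid_regular_hdot {H : hilbertType R} (f : R -> H) (h : H) :
  grid_regular N f -> @grid_regular R R^o N (fun t => hdot (f t) h).
Proof.
move=> gf; apply: (grid_regular_lipschitz (M := `|h|)) gf _ => s t _ _.
by rewrite -hdotBl mulrC; exact: hdot_le.
Qed.

End grid_regularity.

Section tv_measure_integrals.
Context {R : realType} {V : normedModType R} (N : nat) (x : R -> V).
Hypothesis rx : rectifiable_path N x.
Local Notation F := (tv_function N x).
Local Notation mu := (tv_measure N x).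
Local Notation D := (`[0, N%:R]%classic : set (measurableTypeR R)).
Local Notation integr f := (mu.-integrable D (EFin \o f)).

(** No atoms, because [F] is continuous; so cells may be closed or half-open. *)
Lemma tv_measure_set1 (a : R) : mu [set a] = 0%E.
Proof.
apply/eqP; rewrite eq_le measure_ge0 andbT.
apply/lee_addgt0Pr => e e0; rewrite add0e.
have [dl dl0 h] := ucont_tv_function rx e0.
have ab : a - dl / 2 <= a by rewrite gerBl divr_ge0// ltW.
apply: (@le_trans _ _ (mu `]a - dl / 2, a]%classic)).
  apply: le_measure; rewrite ?inE.
  - exact: measurable_set1.
  - exact: measurable_itv.
  - by move=> _ ->; rewrite /= in_itv/= lexx andbT ltrBlDr ltrDl divr_gt0.
rewrite tv_measure_oc// lee_fin tv_function_clamp [X in _ - X]tv_function_clamp.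
apply/ltW; apply: le_lt_trans (ler_norm _) _; apply: h; [exact: clamp_in..|].
apply: le_lt_trans (clamp_dist _ _ _) _.
by rewrite subKr gtr0_norm ?divr_gt0//; lra.
Qed.

Lemma tv_measure_cc (a b : R) : a <= b -> mu `[a, b]%classic = (F b - F a)%:E.
Proof.
move=> ab; rewrite -(@setU1itv _ _ _ _ false); last by rewrite bnd_simp.
rewrite measureU.
- by rewrite [X in (X + _)%E](tv_measure_set1 a) add0e; exact: tv_measure_oc.
- exact: measurable_set1.
- exact: measurable_itv.
- by apply/seteqP; split => // y [/= ->]; rewrite in_itv/= ltxx.
Qed.

Lemma tv_measure_co (a b : R) : a <= b -> mu `[a, b[%classic = (F b - F a)%:E.
Proof.
move=> ab; rewrite -tv_measure_cc// -(@setUitv1 _ _ _ _ true); last first.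
  by rewrite bnd_simp.
rewrite measureU.
- by rewrite [X in (_ + X)%E](tv_measure_set1 b) adde0.
- exact: measurable_itv.
- exact: measurable_set1.
- by apply/seteqP; split => // y [/= + yb]; rewrite yb in_itv/= ltxx andbF.
Qed.

Let mD : measurable D. Proof. exact: measurable_itv. Qed.

Lemma tv_measure_total : mu D = (F N%:R)%:E.
Proof. by rewrite tv_measure_cc// tv_function0// subr0. Qed.

Let muD : (mu D < +oo)%E. Proof. by rewrite tv_measure_total ltry. Qed.

(** Left-point Stieltjes sum against |dx|, for scalar and vector integrands alike. *)
Definition grid_sum {W : lmodType R} (f : R -> W) n : W :=
  \sum_(0 <= j < N * n.+1)
    (F (gridpt n j.+1) - F (gridpt n j)) *: f (gridpt n j).

Lemma Rintegral_gridfloor (f : R -> R) n :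
  integr (f \o gridfloor n) /\
  \int[mu]_(t in D) f (gridfloor n t) = @grid_sum R^o f n.
Proof.
pose E j := (`[gridpt n j, gridpt n j.+1[%classic : set (measurableTypeR R)).
have mE j : measurable (E j) by exact: measurable_itv.
have lej j : gridpt n j <= gridpt n j.+1 :> R by rewrite gridpt_le.
have muE j : mu (E j) = (F (gridpt n j.+1) - F (gridpt n j))%:E.
  exact: tv_measure_co.
have mN : measurable ([set N%:R] : set (measurableTypeR R)).
  exact: (@measurable_set1 R N%:R).
pose e j t := (f (gridpt n j) * \1_(E j) t) : R.
(* [gridfloor n] is constant on half-open cells, which leave out the point N; that point is null. *)
pose e' t := (f N%:R * \1_([set N%:R] : set (measurableTypeR R)) t) : R.
have rep t : D t -> f (gridfloor n t) = \sum_(0 <= j < N * n.+1) e j t + e' t.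
  rewrite /= in_itv/= => tN; have /andP[t0 tN'] := tN.
  have := gridindex_itv n t0; rewrite /gridfloor.
  set k := gridindex n t => /andP[k1 k2].
  have eE j : j != k -> e j t = 0.
    move=> jk; rewrite /e indicE memNset ?mulr0// /E /= in_itv/= => tj.
    by move: jk; rewrite -(gridindexP tj) eqxx.
  have [kN|Nk] := ltnP k (N * n.+1)%N.
    rewrite (bigD1_seq k) ?iota_uniq ?mem_index_iota//=.
    rewrite big1 => [|j jk]; last exact: eE.
    rewrite /e indicE mem_set ?/E /= ?in_itv/= ?k1// mulr1 addr0.
    rewrite /e' indicE memNset ?mulr0 ?addr0//= => tE.
    by move: kN; rewrite ltnNge -gridpt_leE// gridpt_end tE lexx.
  have tE : t = N%:R.
    apply/eqP; rewrite eq_le tN' /= -(gridpt_end n).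
    by rewrite gridpt_leE.
  rewrite big_nat big1 ?add0r; last first.
    move=> j /andP[_ jN]; apply: eE; rewrite neq_ltn.
    by rewrite (leq_trans jN Nk).
  rewrite /e' tE indicE mem_set//= mulr1; congr f.
  by rewrite /k tE -(gridpt_end n) gridindex_pt.
have ind A : measurable A -> integr (\1_A : _ -> R).
  move=> mA; apply: measurable_bounded_integrable => //.
  exists 1; split => // M M1 y _ /=.
  rewrite ger0_norm ?indic_ge0//; apply: le_trans (ltW M1).
  by rewrite indicE; case: (_ \in _).
have ei j : integr (e j) by exact: (integrZl mD _ (ind _ (mE j))).
have e'i : integr e'.
  by exact: (integrZl mD _ (ind _ mN)).
have [s1 s2] := Rintegral_sum mD muD (index_iota 0 (N * n.+1)) ei.
have si := integrD mD s1 e'i.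
split.
  apply: eq_integrable si => // t /set_mem Dt /=.
  by rewrite rep.
rewrite (@eq_Rintegral _ _ _ _ D
  (fun t => \sum_(0 <= j < N * n.+1) e j t + e' t)).
  rewrite RintegralD// s2 [X in _ + X](_ : _ = 0) ?addr0; last first.
    rewrite RintegralZl//; last exact: (ind _ mN).
    rewrite /Rintegral integral_indic//.
    rewrite (_ : _ `&` _ = [set N%:R]); first by rewrite tv_measure_set1 mulr0.
    by apply/seteqP; split => [y []//|y /= ->]; rewrite in_itv/= lexx ler0n.
  rewrite /grid_sum big_nat [RHS]big_nat; apply: eq_bigr => j /andP[_ jN].
  rewrite RintegralZl//; last exact: ind.
  rewrite /Rintegral integral_indic// mulrC.
  rewrite (_ : _ `&` _ = E j) ?muE//.
  apply/seteqP; split => [y []//|y] /=; rewrite /E /= in_itv/= => /andP[y1 y2].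
  have y0N : 0 <= y <= N%:R.
    by rewrite (le_trans _ y1) ?gridpt_ge0//= (le_trans (ltW y2))// gridpt_leN.
  by split; rewrite ?in_itv//= y1.
by move=> t /set_mem; exact: rep.
Qed.

Lemma grid_regular_integral (f : R -> R) : @grid_regular R R^o N f ->
  integr f /\ @grid_sum R^o f @ \oo --> \int[mu]_(t in D) f t.
Proof.
move=> gf.
have mf : measurable_fun D f.
  apply: (@measurable_fun_cvg _ _ _ _ (fun n t => f (gridfloor n t))).
    move=> n; have [h _] := Rintegral_gridfloor f n.
    by apply/measurable_EFinP; exact: measurable_int h.
  move=> t; rewrite /= in_itv/= => tN; apply/cvgrPdist_lt => e e0.
  have [n0 h] := gf e e0; exists n0 => // n /= nn; rewrite distrC; exact: h.
have fi : integr f.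
  have [n /(_ n (leqnn _)) h] := gf _ ltr01.
  apply: (integr_norm_le mD (g := fun t => `|f (gridfloor n t)| + 1)) => //.
    move=> t; rewrite /= in_itv/= => tN; have h1 := h t tN.
    have := ler_normB (f (gridfloor n t)) (f (gridfloor n t) - f t).
    by rewrite subKr; move: h1; lra.
  apply: (integrD mD); last exact: integr_cst.
  by apply: integrable_norm; have [] := Rintegral_gridfloor f n.
split => //; apply/cvgrPdist_le => e e0.
have C0 : 0 < F N%:R + 1.
  rewrite ltr_wpDl// -[leLHS](tv_function0 rx).
  by apply: le_tv_function.
have [n0 h] := gf _ (divr_gt0 e0 C0); exists n0 => // n /= nn.
have [i1 <-] := Rintegral_gridfloor f n.
rewrite -RintegralB//.
have i2 : integr (fun t => f t - f (gridfloor n t)).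
  exact: (integrableB mD fi i1).
apply: le_trans (le_normr_Rintegral mD i2) _.
apply: (@le_trans _ _ (\int[mu]_(t in D) (e / (F N%:R + 1)))).
  apply: le_Rintegral => //; first exact: integrable_norm.
    exact: integr_cst.
  by move=> t; rewrite /= in_itv/= => tN; rewrite distrC; apply/ltW/h.
rewrite Rintegral_cst// tv_measure_total /= mulrAC ler_pdivrMr//.
by rewrite ler_wpM2l ?lerDl// ltW.
Qed.

Section vector_valued.
Context {H : hilbertType R} (f : R -> H).
Hypothesis gf : grid_regular N f.

Lemma measurable_clamp : measurable_fun [set: measurableTypeR R]
  (fun t : measurableTypeR R => Num.min (Num.max (t : R) 0) N%:R : R).
Proof.
apply: measurable_minr; last exact: measurable_cst.
by apply: measurable_maxr; [exact: measurable_id|exact: measurable_cst].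
Qed.

(** [f] is controlled only on [0, N], while [simple_limit] asks for convergence everywhere; the
    clamp is the identity on [0, N]. *)
Lemma simple_limit_clamp :
  simple_limit (fun t : measurableTypeR R => f (Num.min (Num.max t 0) N%:R)).
Proof.
pose c (t : measurableTypeR R) : R := Num.min (Num.max (t : R) 0) N%:R.
apply: (@simple_limit_lim _ _ _ _ (fun n t => f (gridfloor n (c t)))).
  move=> n.
  rewrite (_ : (fun t => _) = fun t => f 0 + \sum_(0 <= j < N * n.+1)
    (if gridpt n j.+1 <= c t then f (gridpt n j.+1) - f (gridpt n j) else 0)).
    apply: simple_limitD; first exact: simple_limit_cst.
    apply: simple_limit_sum => j _; apply: simple_limit_simple.
    apply: simple_function_if; [|exact: simple_function_cst..].
    rewrite -[X in measurable X]setTI.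
    apply: (@measurable_fun_ler _ _ _ setT (fun=> gridpt n j.+1) c) => //.
    exact: measurable_clamp.
  by apply/funext => t; apply: gridfloor_telescope; exact: clamp_in.
move=> t; apply/cvgrPdist_lt => e e0.
have [n0 h] := gf e0; exists n0 => // n /= nn; rewrite distrC.
by apply: h => //; exact: clamp_in.
Qed.

Let clampE t : D t -> Num.min (Num.max t 0) N%:R = t.
Proof. by rewrite /= in_itv/= => /andP[t0 tN]; rewrite max_l// min_l. Qed.

Local Notation I := (bochner_integral mu D f).

Lemma bochner_integral_tv_hdot h :
  hdot I h = \int[mu]_(t in D) hdot (f t) h.
Proof.
rewrite (bochner_integralE mD muD simple_limit_clamp).
- by apply: eq_Rintegral => t /set_mem Dt; rewrite clampE.
- have [ni _] := grid_regular_integral (grid_regular_norm gf).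
  by apply: eq_integrable ni => // t /set_mem Dt /=; rewrite clampE.
- by apply: aeW => t Dt; rewrite clampE.
Qed.

(** A limit of finite sums of values on grids: the form that shows the integral along a random path
    to be measurable in w. *)
Lemma grid_sum_cvg_bochner : grid_sum f @ \oo --> I.
Proof.
apply/cvgrPdist_le => e e0.
have C0 : 0 < F N%:R + 1.
  rewrite ltr_wpDl// -[leLHS](tv_function0 rx).
  by apply: le_tv_function.
have [n0 h] := gf (divr_gt0 e0 C0); exists n0 => // n /= nn.
(* Testing u against itself gives |u|^2 <= |u| e. *)
set u := I - _.
have [i1 e1] := Rintegral_gridfloor (fun t => hdot (f t) u) n.
have [i2 _] := grid_regular_integral (grid_regular_hdot u gf).
have uu : `|u| ^+ 2 <= `|u| * e.
  rewrite -hdot_norm {1}/u hdotBl bochner_integral_tv_hdot.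
  have -> : hdot (grid_sum f n) u =
      \int[mu]_(t in D) hdot (f (gridfloor n t)) u.
    by rewrite e1 /grid_sum hdot_suml; apply: eq_bigr => j _; rewrite hdotZl.
  rewrite -RintegralB//.
  apply: (@le_trans _ _ (\int[mu]_(t in D) (`|u| * (e / (F N%:R + 1))))).
    apply: le_Rintegral => //;
      [exact: (integrableB mD i2 i1)|exact: integr_cst|].
    move=> t; rewrite /= in_itv/= => tN; rewrite -hdotBl.
    apply: le_trans (ler_norm _) _; apply: le_trans (hdot_le _ _) _.
    by rewrite mulrC ler_wpM2l// distrC; apply/ltW/h.
  rewrite Rintegral_cst// tv_measure_total /= -mulrA ler_wpM2l//.
  by rewrite mulrAC ler_pdivrMr// ler_wpM2l ?lerDl// ltW.
have [->|u0] := eqVneq u 0; first by rewrite normr0 ltW.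
by move: uu; rewrite expr2 ler_pM2l ?normr_gt0.
Qed.

Lemma integral_norm_add_sqr v :
  (\int[mu]_(t in D) (`|f t + v| ^+ 2)%:E)%E =
  (\int[mu]_(t in D) `|f t| ^+ 2 + 2 * hdot I v + F N%:R * `|v| ^+ 2)%:E.
Proof.
have [i1 _] := grid_regular_integral (grid_regular_normsq gf).
have [i2 _] := grid_regular_integral (grid_regular_hdot v gf).
have i3 := integr_cst mD muD (`|v| ^+ 2).
have i4 := integrZl mD 2 i2.
have i5 := integrD mD i1 i4.
have i6 := integrD mD i5 i3.
rewrite (_ : (fun t => _) =
  EFin \o (fun t => `|f t| ^+ 2 + 2 * hdot (f t) v + `|v| ^+ 2)); last first.
  by apply/funext => t /=; rewrite normD_sqr.
rewrite -[LHS]fineK; last exact: integrable_fin_num.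
congr EFin; rewrite bochner_integral_tv_hdot.
rewrite -[LHS]/(\int[mu]_(t in D) (`|f t| ^+ 2 + 2 * hdot (f t) v + `|v| ^+ 2)).
rewrite RintegralD// RintegralD// RintegralZl// Rintegral_cst//.
by rewrite tv_measure_total /= mulrC (mulrC (F _)).
Qed.

End vector_valued.

End tv_measure_integrals.


(** * The sawtooth signature of a fixed path *)

Section sawtooth_paths.
Context {R : realType} {V : hilbertType R} {T : tensorPowers V} (N : nat).

Lemma reset_time_gridfloor dir n (t : R) : 0 <= t ->
  reset_time dir (gridfloor n t) = reset_time dir t.
Proof.
by move=> t0; case: dir => /=; rewrite ?floorDrz// ?floor_gridfloor.
Qed.

Lemma reset_time_nat dir (t : R) : 0 <= t ->
  exists k : nat, reset_time dir t = k%:R.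
Proof.
move=> t0; case: dir => /=.
- have : 0 <= Num.floor t by rewrite floor_ge0.
  by case: (Num.floor t) => // k _; exists k.
- have : 0 <= Num.floor (t + 1) by rewrite floor_ge0 addr_ge0.
  by case: (Num.floor (t + 1)) => // k _; exists k.
Qed.

Lemma sawtooth1 dir (x : R -> V) (b : tseries T) t :
  sawtooth dir N x b 1 t =
  tens (x t - x (Num.min (reset_time dir t) N%:R)) (tone T) + b 1%N.
Proof. by []. Qed.

Lemma sawtoothSS dir (x : R -> V) (b : tseries T) l :
  sawtooth dir N x b l.+2 =
  fun t => b l.+2 + RS_integral x (sawtooth dir N x b l.+1) 0 t.
Proof. by []. Qed.

Lemma sawtooth_grid_regular dir (x : R -> V) (b : tseries T) l :
  rectifiable_path N x -> grid_regular N (sawtooth dir N x b l).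
Proof.
move=> rx; have ux : ucont N x by apply: within_continuous_ucont; case: rx.
elim: l => [|[|l] IH].
- by apply: ucont_grid_regular; exact: ucont_cst.
- move=> e e0; have [n0 h] := ucont_grid_regular ux e0; exists n0 => n nn t tN.
  (* The reset time is the same at t and at its left grid point, so the reset values cancel. *)
  rewrite !sawtooth1 reset_time_gridfloor; last by case/andP: tN.
  rewrite opprD addrACA subrr addr0 -tensBl opprB addrA subrK norm_tens.
  by rewrite tone_norm mulr1; exact: h.
- rewrite sawtoothSS; apply: ucont_grid_regular.
  apply: ucontD; first exact: ucont_cst.
  exact: (ucont_RS_integral (tv_function_control rx) ux IH).
Qed.

Lemma sawtooth_extend dir (x : R -> V) (b : tseries T) m (v : T m.+1) t :
  sawtooth dir N x (extend b v) m.+1 t =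
  sawtooth dir N x (extend b (0 : T m.+1)) m.+1 t + v.
Proof.
have ext l (u : T m.+1) : (l < m.+1)%N -> extend b u l = b l.
  by move=> lm; rewrite /extend dfwithout// neq_ltn lm orbT.
have eq l s : (l < m.+1)%N -> sawtooth dir N x (extend b v) l s =
    sawtooth dir N x (extend b (0 : T m.+1)) l s.
  elim: l s => [//|[|l] IH] s lm; first by rewrite !sawtooth1 !ext.
  rewrite !sawtoothSS !ext//; congr (_ + RS_integral _ _ _ _).
  by apply/funext => r; apply: IH; exact: ltnW.
have extm (u : T m.+1) : extend b u m.+1 = u by exact: dfwithin.
(* In degree 1 the top component is an explicit increment; from degree 2 on it is an integral of the
   component below. *)
case: m v ext eq extm => [|m] v ext eq extm.
  by rewrite !sawtooth1 !extm addr0.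
rewrite !sawtoothSS !extm add0r addrC; congr (RS_integral _ _ _ _ + _).
by apply/funext => r; exact: (eq m.+1 r (ltnSn _)).
Qed.

End sawtooth_paths.

(** * Measurability of path functionals in w *)

Section random_paths.
Context d (S : measurableType d) (R : realType) (V : hilbertType R).
Context (T : tensorPowers V) (N : nat).

(** The rationals of [0, N]. They are stable under min with grid points, as the stopped grids in
    [gridRS] and [grid_variation] require. *)
Definition on_grid (t : R) :=
  exists n j, t = gridpt n j /\ t <= N%:R.

Lemma on_grid_pt n j : (j <= N * n.+1)%N -> on_grid (gridpt n j).
Proof. by move=> jN; exists n, j; rewrite gridpt_leN. Qed.

Lemma on_grid_in t : on_grid t -> 0 <= t <= N%:R.
Proof. by move=> [n [j [-> ->]]]; rewrite gridpt_ge0. Qed.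

Lemma on_grid_min n j t : on_grid t -> on_grid (Num.min (gridpt n j) t).
Proof.
move=> gt; rewrite /Num.min; case: ifP => // lt.
exists n, j; split => //; apply: le_trans (ltW lt) _.
by have /andP[] := on_grid_in gt.
Qed.

Lemma on_grid_end : on_grid N%:R.
Proof. by exists 0%N, N; rewrite /gridpt divr1. Qed.

Lemma on_grid0 : on_grid 0.
Proof. by exists 0%N, 0%N; rewrite gridpt0. Qed.

Variable Y : R -> S -> V.
Hypotheses (rY : forall w, rectifiable_path N (Y ^~ w))
  (mY : forall t, on_grid t -> simple_limit (Y t)).

Lemma measurable_tv_function t : on_grid t ->
  measurable_fun setT (fun w => tv_function N (Y ^~ w) t).
Proof.
move=> gt.
apply: (@measurable_fun_cvg _ _ _ _
  (fun n w => grid_variation N (Y ^~ w) n t)) => [n|w _]; last first.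
  by apply: grid_variation_cvg => //; exact: on_grid_in.
apply: measurable_sum => j.
have := simple_limit_norm 0 (simple_limitB (mY (on_grid_min n j.+1 gt))
  (mY (on_grid_min n j gt))).
by under eq_fun do rewrite subr0.
Qed.

Lemma simple_limit_grid_sum (H : normedModType R) (f : S -> R -> H) n :
  (forall t, on_grid t -> simple_limit (fun w => f w t)) ->
  simple_limit (fun w => grid_sum N (Y ^~ w) (f w) n).
Proof.
move=> mf; apply: simple_limit_sum => j jN; apply: simple_limitZ.
  by apply: measurable_funB; apply: measurable_tv_function; apply: on_grid_pt;
    rewrite // ltnW.
by apply: mf; apply: on_grid_pt; exact: ltnW.
Qed.

(** At a grid time the integral is a limit of [gridRS], which samples the path and the component
    below at grid times only. *)
Lemma simple_limit_sawtooth dir (b : tseries T) l t : on_grid t ->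
  simple_limit (fun w => sawtooth dir N (Y ^~ w) b l t).
Proof.
elim: l t => [|[|l] IH] t gt; first exact: simple_limit_cst.
  rewrite (_ : (fun w => _) = fun w => tens (Y t w -
    Y (Num.min (reset_time dir t) N%:R) w) (tone T) + b 1%N)//.
  apply: simple_limitD; last exact: simple_limit_cst.
  apply: simple_limit_tens; last exact: simple_limit_cst.
  apply: simple_limitB; first exact: mY.
  have /andP[t0 _] := on_grid_in gt.
  have [k ->] := reset_time_nat dir t0.
  (* An integer is a point of the grid of step 1, the case n = 0. *)
  rewrite (_ : k%:R = gridpt 0 k); last by rewrite /gridpt divr1.
  by apply: mY; apply: on_grid_min; exact: on_grid_end.
rewrite (_ : (fun w => _) = fun w => b l.+2 +
  RS_integral (Y ^~ w) (sawtooth dir N (Y ^~ w) b l.+1) 0 t)//.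
apply: simple_limitD; first exact: simple_limit_cst.
apply: (@simple_limit_lim _ _ _ _ (fun k w =>
  gridRS N (Y ^~ w) (sawtooth dir N (Y ^~ w) b l.+1) k t)).
  move=> k; apply: simple_limitD.
    apply: simple_limit_tens; last by apply: IH; exact: on_grid0.
    by apply: simple_limitB; apply: mY => //; exact: on_grid0.
  apply: simple_limit_sum => j jN; apply: simple_limit_tens.
    by apply: simple_limitB; apply: mY => //; exact: on_grid_min.
  by apply: simple_limitB; apply: IH; apply: on_grid_pt => //; exact: ltnW.
move=> w; have ux : ucont N (Y ^~ w).
  by apply: within_continuous_ucont; case: (rY w).
exact: (RS_integral_cvg (tv_function_control (rY w)) ux
  (sawtooth_grid_regular dir b l.+1 (rY w)) (on_grid_in gt)).
Qed.

End random_paths.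

Lemma rectifiable_modification d (Omega : measurableType d) (R : realType)
    (V : hilbertType R) (P : probability Omega R) (N : nat)
    (X : R -> Omega -> V) : rectifiable_process P N X ->
  exists Y : R -> Omega -> V,
    [/\ {ae P, forall w, Y ^~ w = X ^~ w},
        forall w, rectifiable_path N (Y ^~ w) &
        forall t, on_grid N t -> simple_limit (Y t)].
Proof.
move=> [mX rX].
have /choice[s hs] : forall p : nat * nat, exists s : nat -> Omega -> V,
    (forall k, simple_function (s k)) /\
    {ae P, forall w, (p.2 <= N * p.1.+1)%N ->
      s ^~ w @ \oo --> X (gridpt p.1 p.2) w}.
  move=> [n j] /=; have [jN|jN] := boolP (j <= N * n.+1)%N; last first.
    exists (fun _ _ => 0); split; first by move=> _; exact: simple_function_cst.
    exact: aeW.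
  have [|s ss sX] := mX (gridpt n j).
    by rewrite in_itv/= gridpt_ge0 gridpt_leN.
  by exists s; split => //; apply: filterS sX => w h _; exact: h.
(* Codes of pairs turn the countable family of convergences into a sequence of almost sure
   statements. *)
have aeX : {ae P, forall w, forall i, if @unpickle (nat * nat)%type i is Some p
    then (p.2 <= N * p.1.+1)%N -> s p ^~ w @ \oo --> X (gridpt p.1 p.2) w
    else True}.
  apply: ae_foralln => i; case: unpickle => [p|]; last exact: aeW.
  by have [] := hs p.
have : {ae P, forall w, rectifiable_path N (X ^~ w) /\ forall n j,
    (j <= N * n.+1)%N -> s (n, j) ^~ w @ \oo --> X (gridpt n j) w}.
  apply: filterS2 rX aeX => w rw sw; split => // n j.
  by have := sw (pickle (n, j)); rewrite pickleK.
move=> [A [mA A0 hA]].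
(* Whole paths are replaced, so X and Y agree almost surely as paths, not just at each time.
   Measurability of A keeps the modified approximations simple. *)
exists (fun t w => if w \in A then 0 else X t w); split.
- exists A; split => // w /=; apply: contra_notP => Aw.
  by apply/funext => t; rewrite memNset.
- move=> w; have [wA|wA] := boolP (w \in A).
    split.
      by apply/subspace_continuousP => t _; exact: cvg_cst.
    exists 0 => _ [p _ <-]; rewrite /vvariation big1// => i _ /=.
    by rewrite subrr normr0.
  have : ~ A w by move/negP: wA; apply: contra_not => /mem_set.
  by move=> Aw; have [] : _ /\ _ := contrapT (contra_not (@hA w) Aw).
- move=> _ [n [j [-> ]]]; rewrite gridpt_leN => jN.
  exists (fun k w => if w \in A then 0 else s (n, j) k w).
    move=> k; apply: simple_function_if.
    + by rewrite (_ : [set w | w \in A] = A)//; apply/seteqP; split=> w /=;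
        [move/set_mem|move/mem_set].
    + exact: simple_function_cst.
    + by case: (hs (n, j)).
  move=> w; case: ifPn => wA; first exact: cvg_cst.
  have Aw : ~ A w by move/negP: wA; apply: contra_not => /mem_set.
  by have [_] : _ /\ _ := contrapT (contra_not (@hA w) Aw); exact.
Qed.

(** * Minimisation of the quadratic functional *)

Lemma quadratic_argmin {R : realType} {H : hilbertType R} (a l : R) (c : H) :
  0 < l ->
  [set v : H | forall w : H,
     ((a + 2 * hdot c v + l * `|v| ^+ 2)%:E <=
      (a + 2 * hdot c w + l * `|w| ^+ 2)%:E)%E] = [set - (l^-1 *: c)].
Proof.
move=> l0; set v0 := - (l^-1 *: c).
have key v : a + 2 * hdot c v + l * `|v| ^+ 2 =
    a + 2 * hdot c v0 + l * `|v0| ^+ 2 + l * `|v - v0| ^+ 2.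
  have cE : c = - l *: v0.
    by rewrite scalerN scaleNr opprK scalerA divff ?scale1r// gt_eqF.
  set u := v - v0.
  have cu : hdot c u = - l * hdot v0 u by rewrite [in LHS]cE hdotZl.
  have -> : v = v0 + u by rewrite addrC subrK.
  by rewrite hdotDr normD_sqr cu; ring.
apply/seteqP; split => [v hv|_ -> w]; last first.
  by rewrite lee_fin (key w) lerDl mulr_ge0// ?ltW// sqr_ge0.
have := hv v0; rewrite lee_fin (key v) gerDl pmulr_rle0// => h.
apply/eqP; rewrite -subr_eq0 -normr_eq0 -sqrf_eq0 eq_le h.
exact: sqr_ge0.
Qed.

Unset Implicit Arguments.

Theorem theorem4p1 (R : realType) (V : hilbertType R) (T : tensorPowers V)
    (d : measure_display) (Omega : measurableType d) (P : probability Omega R)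
    (N : nat) (N_ge1 : (1 <= N)%N) (X : R -> Omega -> V)
    (X_rect : rectifiable_process P N X)
    (length_fin : (0 < expected_length P N X < +oo)%E)
    (m : nat) (b : tseries T) (b_T1 : T1 m b) (dir : direction)
    (proper : exists v : T m.+1, (expected_square P N X dir b v < +oo)%E) :
  [set v : T m.+1 | forall w : T m.+1,
     (expected_square P N X dir b v <= expected_square P N X dir b w)%E]
  = [set optimal_datum P N X dir m b].
Proof.
have [Y [YX rY mY]] := rectifiable_modification X_rect.
pose f w := sawtooth dir N (Y ^~ w) (extend b (0 : T m.+1)) m.+1.
have gf w : grid_regular N (f w) by exact: sawtooth_grid_regular.
have mf t : on_grid N t -> simple_limit (f ^~ t).
  exact: simple_limit_sawtooth.
pose D : set (measurableTypeR R) := `[0, N%:R]%classic.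
pose L w := tv_function N (Y ^~ w) N%:R.
pose I w := bochner_integral (tv_measure N (Y ^~ w)) D (f w).
pose q w := Rintegral (tv_measure N (Y ^~ w)) D (fun t => `|f w t| ^+ 2).
have mL : measurable_fun setT L.
  by apply: measurable_tv_function => //; exact: on_grid_end.
have mI : simple_limit I.
  apply: (@simple_limit_lim _ _ _ _ (fun n w => grid_sum N (Y ^~ w) (f w) n)).
    by move=> n; exact: simple_limit_grid_sum.
  by move=> w; exact: grid_sum_cvg_bochner.
have mq : measurable_fun setT q.
  apply: simple_limit_measurable.
  apply: (@simple_limit_lim _ _ _ _
    (fun n w => @grid_sum _ _ N (Y ^~ w) R^o (fun t => `|f w t| ^+ 2) n)).
    move=> n; apply: simple_limit_grid_sum => // t gt.
    apply: measurable_simple_limit; apply: measurable_funX.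
    have := simple_limit_norm 0 (mf t gt).
    by under eq_fun do rewrite subr0.
  move=> w.
  by have [] := grid_regular_integral (rY w) (grid_regular_normsq (gf w)).
have L0 w : 0 <= L w.
  by rewrite /L -(tv_function0 (rY w)); apply: le_tv_function.
(* The inner integral along X is not known to be measurable in w; it is traded for the one along Y,
   equal to it almost surely. *)
have lenE : expected_length P N X = (\int[P]_w (L w)%:E)%E.
  apply: ge0_integral_ae_eq.
  - by move=> w _; exact: integral_ge0.
  - by move=> w _; rewrite lee_fin.
  - apply: filterS YX => w <- _.
    rewrite integral_cst ?mul1e; last exact: measurable_itv.
    exact: tv_measure_total.
have inner w v : (\int[tv_measure N (Y ^~ w)]_(t in D)
    (`|sawtooth dir N (Y ^~ w) (extend b v) m.+1 t| ^+ 2)%:E)%E =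
    (q w + 2 * hdot (I w) v + L w * `|v| ^+ 2)%:E.
  rewrite -(integral_norm_add_sqr (rY w) (gf w)).
  by apply: eq_integral => t _; rewrite sawtooth_extend.
(* Used below at 0, at 2 v and at minus the direction of [I w]. *)
have inner0 w v : 0 <= q w + 2 * hdot (I w) v + L w * `|v| ^+ 2.
  by rewrite -lee_fin -inner integral_ge0// => t _; rewrite lee_fin sqr_ge0.
have sqE v : expected_square P N X dir b v =
    (\int[P]_w (q w + 2 * hdot (I w) v + L w * `|v| ^+ 2)%:E)%E.
  apply: ge0_integral_ae_eq.
  - by move=> w _; apply: integral_ge0 => t _; rewrite lee_fin sqr_ge0.
  - by move=> w _; rewrite lee_fin.
  - by apply: filterS YX => w <- _; exact: inner.
have mS v : measurable_fun setT
    (fun w => q w + 2 * hdot (I w) v + L w * `|v| ^+ 2).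
  apply: measurable_funD; last by apply: measurable_funM.
  apply: measurable_funD => //; apply: measurable_funM => //.
  exact: simple_limit_hdot.
have q0 w : 0 <= q w.
  have := inner0 w 0.
  by rewrite normr0 expr0n /= mulr0 addr0 hdotC hdot0l mulr0 addr0.
have PT : (P setT < +oo)%E by rewrite probability_setT ltry.
have mT := @measurableT _ Omega.
move: length_fin; rewrite lenE => /andP[len0 len1].
have iL : P.-integrable setT (EFin \o L).
  apply/integrableP; split; first exact/measurable_EFinP.
  rewrite (eq_integral (fun w => (L w)%:E))// => w _.
  by rewrite /= ger0_norm.
have iq : P.-integrable setT (EFin \o q).
  have [v] := proper; rewrite sqE => hv.
  have iS : P.-integrable setT
      (EFin \o (fun w => q w + 2 * hdot (I w) v + L w * `|v| ^+ 2)).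
    apply/integrableP; split; first exact/measurable_EFinP.
    rewrite (eq_integral (fun w =>
      (q w + 2 * hdot (I w) v + L w * `|v| ^+ 2)%:E))// => w _.
    by rewrite /= ger0_norm.
  apply: (integr_norm_le mT _ _ (integrD mT (integrZl mT 2 iS)
    (integrZl mT (2 * `|v| ^+ 2) iL))).
    exact: mq.
  move=> w _; rewrite ger0_norm//.
  (* The polynomial is nonnegative at 2 v, which bounds q by its value at v. *)
  have := inner0 w (2 *: v); rewrite hdotZr normrZ exprMn ger0_norm//.
  lra.
have nI w : 2 * `|I w| <= q w + L w.
  have [->|I0] := eqVneq (I w) 0; first by rewrite normr0 mulr0 addr_ge0.
  (* At minus the unit vector along [I w] the polynomial equals q - 2 |I| + L. *)
  have := inner0 w (- (`|I w|^-1 *: I w)).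
  rewrite normrN normrZ ger0_norm ?invr_ge0// mulVf ?normr_eq0// expr1n.
  rewrite hdotC hdotNl hdotZl hdot_norm expr2 mulrA mulVf ?normr_eq0//; lra.
have iI : P.-integrable setT (EFin \o (fun w => `|I w|)).
  apply: (integr_norm_le mT _ _ (integrD mT iq iL)).
    have := simple_limit_norm 0 mI.
    by under eq_fun do rewrite subr0.
  by move=> w _; rewrite normr_id; have := nI w; have := normr_ge0 (I w); lra.
pose c := bochner_integral P setT (fun w =>
  bochner_integral (tv_measure N (X ^~ w)) D
    (sawtooth dir N (X ^~ w) (extend b (0 : T m.+1)) m.+1)).
have cE h : hdot c h = Rintegral P setT (fun w => hdot (I w) h).
  apply: bochner_integralE => //.
  by apply: filterS YX => w <- _.
pose a := Rintegral P setT q; pose l := Rintegral P setT L.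
have lE : (\int[P]_w (L w)%:E)%E = l%:E.
  by rewrite /l /Rintegral fineK//; exact: integrable_fin_num.
have l0 : 0 < l by rewrite -lte_fin -lE.
have sqE' v : expected_square P N X dir b v =
    (a + 2 * hdot c v + l * `|v| ^+ 2)%:E.
  have ih := integr_hdot mT mI iI v.
  have i1 := integrD mT iq (integrZl mT 2 ih).
  have i2 := integrZl mT (`|v| ^+ 2) iL.
  rewrite sqE -[LHS]fineK; last first.
    apply: integrable_fin_num => //.
    by have := integrD mT i1 i2; under eq_fun do rewrite [X in _ + X]mulrC.
  congr EFin; rewrite cE -[LHS]/(Rintegral P setT
    (fun w => q w + 2 * hdot (I w) v + L w * `|v| ^+ 2)).
  under eq_Rintegral do rewrite [X in _ + X]mulrC.
  rewrite (RintegralD mT i1 i2) (RintegralD mT iq (integrZl mT 2 ih)).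
  by rewrite (RintegralZl 2 mT ih) (RintegralZl (`|v| ^+ 2) mT iL) (mulrC l).
(* The expected length is l, so [optimal_datum] is the vertex - c / l of the polynomial. *)
rewrite /optimal_datum lenE lE -/c /=.
rewrite -(quadratic_argmin a c l0).
by apply/seteqP; split => v /= hv w; have := hv w; rewrite !sqE'.
Qed.
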